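(* Let $(T,v^* )$ be an even finite rooted tree, and let $\phi:V(T)\to\mathbb{Z}$ be a uniformly random homomorphism satisfying $\phi\equiv 0$ on the leaves of $T$. Let $R$ be the effective resistance between the root $v^*$ and the leaves. Then the distribution of the height at the root, $\phi(v^* )$, satisfies $$\left|\mathcal{N}_{2\mathbb{Z}\cap(-R/2,R/2)}(0,R/4)\right| \;\le_{st}\; |\phi(v^* )| \;\le_{st}\; \left|\mathcal{N}_{2\mathbb{Z}}(0,4R)\right|.$$ In particular, its variance is bounded by $$\left\lfloor \frac{R}{4e^4\sqrt{\pi}}\right\rfloor \le \mathrm{Var}(\phi(v^* )) \le 4R.$$
   Context: A homomorphism on a graph $G$ is a function $\phi:V(G)\to\mathbb{Z}$ with $|\phi(u)-\phi(v)|=1$ for every edge $(u,v)$. In a rooted tree, the leaves are the vertices with no children. A rooted tree is even if every leaf is at even distance from the root. The effective resistance between the root and the leaves is computed in the electrical network in which every edge of $T$ has resistance $1$ and all leaves are identified to a single node. For a nonempty set $I\subseteq\mathbb{Z}$, $\mathcal{N}_I(0,\sigma^2)$ denotes a discrete Gaussian random variable restricted to $I$, taking value $x\in I$ with probability proportional to $e^{-x^2/(2\sigma^2)}$. $X\le_{st}Y$ means that $Y$ stochastically dominates $X$: $\mathbb{P}(X\ge t)\le\mathbb{P}(Y\ge t)$ for all $t$. *)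

(* Defs.v *)
From HB Require Import structures.
From mathcomp Require Import all_boot all_order all_algebra.
From mathcomp Require Import all_classical all_reals all_analysis.

Set Implicit Arguments.
Unset Strict Implicit.
Unset Printing Implicit Defensive.

Import Order.TTheory GRing.Theory Num.Theory.

Local Open Scope classical_set_scope.
Local Open Scope ring_scope.

Section Trees.
Variables (V : finType) (e : rel V).

Definition acyclic : Prop := forall c : seq V, ucycle e c -> (size c < 3)%N.

Definition is_tree : Prop :=
  [/\ symmetric e, irreflexive e, forall x y, connect e x y & acyclic].

Definition walk (n : nat) (x y : V) : bool :=
  [exists p : n.-tuple V, path e x p && (last x p == y)].

(* The least length of a walk from x to y; equal to #|V| if there is none. *)
Definition dist (x y : V) : nat := find (fun n => walk n x y) (iota 0 #|V|).

Variable root : V.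

Definition child (v w : V) : bool :=
  e v w && (dist root w == (dist root v).+1).

Definition leaves : {set V} := [set v | [forall w, ~~ child v w]]%SET.

Definition even_tree : Prop :=
  forall v, v \in leaves -> ~~ odd (dist root v).

Definition zero_homs : set {ffun V -> int} :=
  [set phi : {ffun V -> int} |
     (forall u v, e u v -> `|phi u - phi v| = 1) /\
     (forall v, v \in leaves -> phi v = 0)].

End Trees.

(* A network is a finite set of nodes with a symmetric family c of
   conductances, c x y being the conductance between the nodes x and y. *)
Section Networks.
Variable R : realType.

(* Kirchhoff's node law and Ohm's law for a unit current from a to z. *)
Definition unit_current_potential (N : finType) (c : N -> N -> R) (a z : N)
    (h : N -> R) : Prop :=
  forall x, \sum_y c x y * (h x - h y) = (x == a)%:R - (x == z)%:R.

(* The value h a - h z does not depend on h when the network is connected. *)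
Definition effective_resistance (N : finType) (c : N -> N -> R) (a z : N) : R :=
  xget 0 [set r | exists h, unit_current_potential c a z h /\ r = h a - h z].

Variables (V : finType) (e : rel V).

(* Identification of the vertices of A to the single node None. *)
Definition collapse (A : {set V}) : V -> option {v : V | v \notin A} :=
  fun v => insub v.

(* Unit resistors on the edges; parallel edges add up their conductances. *)
Definition collapsed_conductance (A : {set V})
    (x y : option {v : V | v \notin A}) : R :=
  \sum_(u | collapse A u == x) \sum_(v | collapse A v == y) (e u v)%:R.

Definition leaf_resistance (root : V) : R :=
  effective_resistance (@collapsed_conductance (leaves e root))
    (collapse (leaves e root) root) None.

End Networks.

(* Alias of X in which all subsets are measurable. *)
Definition discrete (X : Type) : Type := X.

HB.instance Definition _ (X : zmodType) := Choice.on (discrete X).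
HB.instance Definition _ (X : zmodType) := isPointed.Build (discrete X) (0 : X).
HB.instance Definition _ (X : zmodType) :=
  @isMeasurable.Build default_measure_display (discrete X)
    discrete_measurable discrete_measurable0
    (@discrete_measurableC X) (@discrete_measurableU X).

Section Laws.
Local Open Scope ereal_scope.
Variables (R : realType) (X : zmodType).
Variables (w : X -> R) (w_ge0 : forall x, (0 <= w x)%R).

(* The proof argument is there so that the measure instance can be inferred. *)
Definition weight_measure of (forall x, (0 <= w x)%R) :
    set (discrete X) -> \bar R :=
  fun A => \esum_(x in A) (w x)%:E.

Local Notation mass := (weight_measure w_ge0).

Let mass0 : mass set0 = 0. Proof. exact: esum_set0. Qed.

Let mass_ge0 A : 0 <= mass A.
Proof. by apply: esum_ge0 => x _; rewrite lee_fin. Qed.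

Let mass_sigma_additive : semi_sigma_additive mass.
Proof.
move=> F mF tF mUF; apply: cvg_toP.
  apply: ereal_nondecreasing_is_cvgn => a b ab.
  by apply: lee_sum_nneg_natr => // n _ _; exact: mass_ge0.
by rewrite /weight_measure nneseries_sum_bigcup// => x; rewrite lee_fin.
Qed.

HB.instance Definition _ := isMeasure.Build _ _ _ mass
  mass0 mass_ge0 mass_sigma_additive.

(* The law proportional to w.  It is the Dirac mass at 0 in the degenerate
   cases where the total weight is 0 or infinite, e.g. a Gaussian restricted
   to the empty set or with s2 = 0 (both arise only for a one-vertex tree). *)
Definition proportional_law : probability (discrete X) R :=
  mnormalize mass (@dirac _ (discrete X) (0%R : X) R).

End Laws.

Section UniformAndGaussian.
Variable R : realType.

Fact uniform_weight_ge0 (X : zmodType) (S : set X) (x : X) :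
  0 <= \1_S x :> R.
Proof. by rewrite indicE. Qed.

Definition uniform_law (X : zmodType) (S : set X) :
    probability (discrete X) R :=
  proportional_law (uniform_weight_ge0 S).

Definition gauss_weight (I : set int) (s2 : R) (x : int) : R :=
  \1_I x * expR (- (x%:~R ^+ 2 / (2 * s2))).

Fact gauss_weight_ge0 (I : set int) (s2 : R) (x : int) :
  0 <= gauss_weight I s2 x.
Proof. by rewrite mulr_ge0 ?expR_ge0// indicE. Qed.

(* s2 is the variance parameter sigma^2. *)
Definition discrete_gaussian (I : set int) (s2 : R) :
    probability (discrete int) R :=
  proportional_law (gauss_weight_ge0 I s2).

Definition random_zero_hom (V : finType) (e : rel V) (root : V) :
    probability (discrete {ffun V -> int}) R :=
  uniform_law (zero_homs e root).

Definition st_le (d1 d2 : measure_display) (T1 : measurableType d1)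
    (T2 : measurableType d2) (P : probability T1 R) (X : T1 -> R)
    (Q : probability T2 R) (Y : T2 -> R) : Prop :=
  forall t : R, (P [set u | (t <= X u)%R] <= Q [set v | (t <= Y v)%R])%E.

End UniformAndGaussian.

Definition evenZ : set int := [set x : int | (2 %| x)%Z].

Definition sym_interval (R : realType) (b : R) : set int :=
  [set x : int | - b < x%:~R < b].

(* Main.v *)
Require Import Defs.
From HB Require Import structures.
From mathcomp Require Import all_boot all_order all_algebra.
From mathcomp Require Import all_classical all_reals all_analysis.
From mathcomp Require Import measurable_realfun ring lra zify.

Set Implicit Arguments.
Unset Strict Implicit.
Unset Printing Implicit Defensive.

Import Order.TTheory GRing.Theory Num.Theory.
Import numFieldNormedType.Exports.

(* The number of homomorphisms with a given height at the root obeys a recursion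
   along the tree: an edge turns F into k |-> F (k - 1) + F (k + 1), and the
   branches at a vertex are multiplied.  The effective conductance c is
   turned into c / (1 + c) by an edge and adds up over branches.  Three bounds
   on the ratios F (k + 1) / F (k - 1) in terms of c are stable under these
   operations, and so hold at the root with c = 1 / R.  Iterated, they compare F with the two
   Gaussian weights, which gives both stochastic dominations by monotonicity of
   likelihood ratios.  The variance is not deduced from the dominations: the
   ratio bounds are summed by parts, which gives R - 1 <= Var <= 4 R. *)

Local Open Scope classical_set_scope.
Local Open Scope ring_scope.

(** Each bound has a form that survives the product over branches: exponentials multiply,
    [(1 + x) * (1 + y) >= 1 + x + y], and a ratio at least [(1 - x) / (1 + x)] means a relative
    difference at most [x], which composes like tanh. The exponential bound gives the upper
    Gaussian. The rational bound gives the lower Gaussian and R - 1 for the variance. The affine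
    bound is sharper than the exponential near height 0 when R >= 1, and there it is what summation
    by parts needs to reach 4 R; for R <= 1 the exponential bound is used again, with a better first
    ratio. Deducing 4 R from the domination would require estimating the variance of the Gaussian on
    2Z. Ratios compare heights two apart because the height at a vertex has a fixed parity. After an
    edge, the ratio at k involves the old ratios at k - 1 and k + 1; at k = 0 the symmetry of
    heights supplies the missing one. A leaf has infinite conductance, so the induction starts from
    the edge above it, and the tree reduced to its root, where R = 0, is treated apart. *)

(** * Elementary inequalities for the exponential *)

Lemma expR_pade11 (R : realType) (x : R) :
  0 <= x -> (2 - x) * expR x <= 2 + x.
Proof.
move=> x0.
pose h (z : R) := 2 + z - (2 - z) * expR z.
have dh (z : R) : is_derive z 1 h (1 - (1 - z) * expR z).
  rewrite /h.
  apply: is_derive_eq; rewrite /GRing.scale /=; ring.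
have -> : 2 + x = h x + (2 - x) * expR x by rewrite /h; ring.
suff : h 0 <= h x by rewrite /h expR0; lra.
apply: (@ger0_derive1_ndecr R h 0 x) => //.
- move=> z _; rewrite derive1E derive_val -subr_ge0.
  have := expR_ge1Dx (- z); rewrite expRN => h1.
  have e0 := expR_gt0 z.
  rewrite subr0 subr_ge0 -ler_pdivlMr// mul1r; lra.
- apply: derivable_within_continuous => z _; exact: ex_derive.
Qed.

Lemma expR_ge_sqr (R : realType) (x : R) :
  0 <= x -> (1 + x / 2) ^+ 2 <= expR x.
Proof.
move=> x0; have -> : expR x = expR (x / 2) ^+ 2.
  by rewrite expr2 -expRD; congr expR; lra.
apply: lerXn2r; rewrite ?nnegrE ?expR_ge0//; last exact: expR_ge1Dx; lra.
Qed.

Lemma expR_3half_ge (R : realType) : 64 / 15 <= expR (3 / 2 : R).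
Proof.
have -> : expR (3 / 2 : R) = expR (1 / 16) ^+ 24.
  by rewrite -expRM_natl; congr expR; rewrite -[24]/(24%:R); lra.
apply: (@le_trans _ _ ((17 / 16) ^+ 24)); first by lra.
apply: lerXn2r; rewrite ?nnegrE ?expR_ge0//; last (apply: le_trans (expR_ge1Dx _); lra); lra.
Qed.

Lemma expR_ge_quadratic (R : realType) (z : R) :
  3 / 2 <= z -> 8 * z ^+ 2 + 8 * z + 3 / 2 <= 15 / 2 * expR z.
Proof.
move=> z0; have -> : expR z = expR (3 / 2) * expR (z - 3 / 2).
  by rewrite -expRD; congr expR; lra.
have := expR_3half_ge R; set E := expR (3 / 2) => hE.
have : 0 <= z - 3 / 2 by lra.
move=> /expR_ge_sqr; set F := expR _ => hF.
(* The constant 64/15 makes the leading factor [15 / 2 * (64 / 15) = 32]: with [w = z - 3 / 2] this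
   gives [8 * w ^+ 2 + 32 * w + 32], against [8 * w ^+ 2 + 32 * w + 63 / 2] on the left. *)
have : 64 / 15 * (1 + (z - 3 / 2) / 2) ^+ 2 <= E * F.
  by apply: ler_pM; rewrite ?sqr_ge0//; lra.
nra.
Qed.

(** Once [expR (4 * x)] is bounded below by [1 + 4 * x], what remains is [2 * x * (1 - 2 * x) >= 0],
    whence the range of [x]. *)
Lemma onem_le_expRN (R : realType) (x : R) :
  0 <= x -> x <= 1 / 2 -> expR (- (4 * x)) * (1 + x) <= 1 - x.
Proof.
move=> x0 x1.
have h := expR_ge1Dx (4 * x).
have e0 := expR_gt0 (4 * x).
rewrite expRN mulrC ler_pdivrMr//.
have : (1 - x) * (1 + 4 * x) <= (1 - x) * expR (4 * x) by apply: ler_wpM2l => //; lra.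
nra.
Qed.

(* An edge in series with a network of conductance c = 2 y has conductance
   c / (1 + c), whence the exponent on the left. *)
Lemma expR_edge (R : realType) (y : R) (m : nat) : 0 <= y ->
  expR (m.+1%:R * (y / (1 + 2 * y))) * (1 + expR (- (m.+2%:R * y)))
    <= 1 + expR (m%:R * y).
Proof.
move=> y0.
have d0 : 0 < 1 + 2 * y by lra.
(* [z] is the loss in the exponent due to the series resistor; with [A] and [E] below, the claim
   becomes [A * E + E^-1 <= (1 + A) * expR z]. *)
pose z := 2 * m.+1%:R * y ^+ 2 / (1 + 2 * y).
have -> : expR (m.+1%:R * (y / (1 + 2 * y))) = expR (m.+1%:R * y) / expR z.
  rewrite -expRN -expRD; congr expR; rewrite /z; field; lra.
rewrite mulrAC ler_pdivrMr ?expR_gt0//.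
have e0 := expR_gt0 (m%:R * y); have ey := expR_gt0 y.
set A := expR (m%:R * y) in e0 *; set E := expR y in ey *.
have -> : expR (m.+1%:R * y) = A * E.
  by rewrite -expRD; congr expR; rewrite -natr1; ring.
have -> : expR (- (m.+2%:R * y)) = A^-1 * E^-1 ^+ 2.
  rewrite expr2 -!expRN -!expRD; congr expR.
  by rewrite -[m.+2%:R]natr1 -natr1; ring.
have -> : A * E * (1 + A^-1 * E^-1 ^+ 2) = A * E + E^-1.
  by field; rewrite !gt_eqF.
have A1 : 1 <= A by rewrite -expR0 ler_expR mulr_ge0.
have E1 : 1 <= E by rewrite -expR0 ler_expR.
have Ei : E^-1 <= 1 by rewrite invf_le1.
(* Three regimes. In the first one [z >= y], so [expR z] absorbs the factor [E]. *)
have [h|h] := lerP 1 (2 * (m%:R * y)).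
  have : E <= expR z.
    rewrite ler_expR /z ler_pdivlMr//.
    rewrite -natr1; set M := m%:R in h *.
    have : 0 <= y * (2 * (M * y) - 1) by rewrite mulr_ge0// subr_ge0.
    nra.
  move=> hz; apply: (@le_trans _ _ ((1 + A) * E)); first by nra.
  by rewrite ler_wpM2l//; lra.
(* For [y <= 1] the excess over [1 + A] factors as [(E - 1) * (A - E^-1)]; Padé bounds on the
   factors make it comparable with the [z] of [1 + z <= expR z]. *)
have [y1|y1] := lerP y 1.
  set a := m%:R * y in h A A1 e0 *.
  have a0 : 0 <= a by rewrite mulr_ge0.
  have pa := expR_pade11 a0; have py := expR_pade11 y0.
  rewrite -/A in pa; rewrite -/E in py.
  have hz : 1 + z <= expR z := expR_ge1Dx z.
  apply: (@le_trans _ _ ((1 + A) * (1 + z))); last by rewrite ler_wpM2l//; lra.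
  have zE : z = 2 * y * (a + y) / (1 + 2 * y).
    by rewrite /z /a -natr1; congr (_ / _); ring.
  suff : (E - 1) * (A - E^-1) <= (1 + A) * z.
    have : (E - 1) * (A - E^-1) = A * E + E^-1 - A - 1.
      by field; rewrite gt_eqF.
    by move=> ->; lra.
  have h1 : E - 1 <= 2 * y / (2 - y) by rewrite ler_pdivlMr; lra.
  have h2 : (A - E^-1) <= (1 + A) * ((a + y) / (2 + y)).
    have h3 : (2 - y) / (2 + y) <= E^-1.
      by rewrite -[E^-1]mul1r ler_pdivlMr// mulrAC ler_pdivrMr; lra.
    apply: (@le_trans _ _ (A - (2 - y) / (2 + y))); first by lra.
    rewrite -subr_ge0.
    have -> : (1 + A) * ((a + y) / (2 + y)) - (A - (2 - y) / (2 + y)) =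
       (2 + a - (2 - a) * A) / (2 + y) by field; lra.
    by apply: divr_ge0; lra.
  have h4 : 2 * y / (2 - y) * ((a + y) / (2 + y)) <= z.
    rewrite zE -subr_ge0.
    have -> : 2 * y * (a + y) / (1 + 2 * y)
       - 2 * y / (2 - y) * ((a + y) / (2 + y)) =
      2 * y * (a + y) * (3 - 2 * y - y ^+ 2) / ((1 + 2 * y) * ((2 - y) * (2 + y))).
      field; apply/and3P; split; lra.
    apply: divr_ge0; last by rewrite !mulr_ge0//; lra.
    by rewrite !mulr_ge0//; nra.
  apply: (@le_trans _ _ ((2 * y / (2 - y)) * ((1 + A) * ((a + y) / (2 + y))))).
    by apply: ler_pM => //; lra.
  rewrite mulrCA ler_wpM2l//; lra.
(* Now [2 * m * y < 1 < y] leaves only [m = 0], and [z >= y - 1 / 2] reduces the claim to numerical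
   bounds. *)
have m0 : m = 0%N.
  case: m h {A e0 A1 z} => // m; rewrite -natr1 => h; exfalso.
  have : 0 <= m%:R * y by rewrite mulr_ge0.
  lra.
have AE : A = 1 by rewrite /A m0 mul0r expR0.
rewrite AE mul1r.
have hz : expR (y - 1 / 2) <= expR z.
  rewrite ler_expR /z m0 ler_pdivlMr//; nra.
suff : E + E^-1 <= 2 * expR (y - 1 / 2) by move=> ?; lra.
have -> : expR (y - 1 / 2) = E / expR (1 / 2).
  by rewrite -expRN -expRD.
have q0 := expR_gt0 (1 / 2 : R).
have : (2 - 1 / 2) * expR (1 / 2 : R) <= 2 + 1 / 2 by apply: expR_pade11; lra.
set q := expR (1 / 2) in q0 *; move=> hq.
have hqi : 3 / 5 <= q^-1 by rewrite -[q^-1]mul1r ler_pdivlMr//; lra.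
have E2 : 9 / 4 <= E.
  have h1 := @expR_ge_sqr R 1 ltac:(lra).
  have : expR 1 <= E by rewrite ler_expR; lra.
  lra.
have : E * (3 / 5) <= E / q by rewrite ler_pM2l.
have : E^-1 <= 4 / 9 by rewrite -[E^-1]mul1r ler_pdivrMr//; lra.
lra.
Qed.

(** * Height ratios and their stability under products and edges *)

Section HeightBounds.
Variable R : realType.
Implicit Types (c : R) (F G : nat -> R).

(* c is the conductance from the root of a tree to its leaves, and F k the
   number of homomorphisms, zero on the leaves, whose height at the root is k
   (or, equivalently, is - k). *)
Record height_bounds c F : Prop := HeightBounds {
  height_ge0 : forall k, 0 <= F k;
  height_exp_bound : forall k, F k.+2 <= expR (- (c * k.+1%:R / 2)) * F k;
  height_poly_bound : forall k, (1 + c * (5 * k%:R + 4) / 4) * F k.+2 <= F k;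
  height_lower_bound : forall k,
    (1 - c * k.+1%:R) * F k <= (1 + c * k.+1%:R) * F k.+2 }.

(* The predecessor of 0 is 1, since heights k and -k have the same weight. *)
Definition edge_step F (k : nat) : R := F k.+1 + F (if k is j.+1 then j else 1%N).

Lemma height_bounds_one : height_bounds 0 (fun=> 1).
Proof. by split=> k; rewrite ?mul0r ?oppr0 ?expR0 ?mul1r ?addr0 ?subr0. Qed.

(** For the lower bound, relative differences [a] and [b] combine to [(a + b) / (1 + a * b)], which
    is at most [a + b]. *)
Lemma height_bounds_mul c1 c2 F G : 0 <= c1 -> 0 <= c2 ->
  height_bounds c1 F -> height_bounds c2 G ->
  height_bounds (c1 + c2) (fun k => F k * G k).
Proof.
move=> c10 c20 [F0 FB FC FD] [G0 GB GC GD]; split=> k.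
- by rewrite mulr_ge0.
- have -> : - ((c1 + c2) * k.+1%:R / 2) =
    - (c1 * k.+1%:R / 2) + - (c2 * k.+1%:R / 2) by lra.
  by rewrite expRD mulrACA; apply: ler_pM.
- set x := 5 * k%:R + 4.
  have x0 : 0 <= x by rewrite /x; have := ler0n R k; lra.
  have a0 := mulr_ge0 c10 x0; have b0 := mulr_ge0 c20 x0.
  have FG0 : 0 <= F k.+2 * G k.+2 by rewrite mulr_ge0.
  apply: le_trans (ler_pM _ _ (FC k) (GC k)); last 2 first.
  + by rewrite mulr_ge0// addr_ge0// divr_ge0.
  + by rewrite mulr_ge0// addr_ge0// divr_ge0.
  rewrite mulrACA ler_wpM2r//.
  have := mulr_ge0 a0 b0; rewrite -/x; nra.
- set x := k.+1%:R.
  have x0 : 0 <= x by [].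
  have a0 := mulr_ge0 c10 x0; have b0 := mulr_ge0 c20 x0.
  have FG0 : 0 <= F k * G k by rewrite mulr_ge0.
  have FG2 : 0 <= F k.+2 * G k.+2 by rewrite mulr_ge0.
  have := FD k; have := GD k; rewrite -/x.
  set a := c1 * x in a0 *; set b := c2 * x in b0 *.
  have -> : (c1 + c2) * x = a + b by rewrite mulrDl.
  move=> hG hF.
  (* If [a + b >= 1] the left side is nonpositive; otherwise [1 - a] and [1 - b] are positive and
     the two inequalities may be multiplied. *)
  have [h|h] := lerP 1 (a + b).
    by apply: (@le_trans _ _ 0); [rewrite mulr_le0_ge0//; lra|rewrite mulr_ge0//; lra].
  have : (1 - a) * F k * ((1 - b) * G k) <= (1 + a) * F k.+2 * ((1 + b) * G k.+2).
    by apply: ler_pM => //; rewrite mulr_ge0//; lra.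
  rewrite !(mulrACA _ (F _)).
  set p := F k * G k in FG0 *; set q := F k.+2 * G k.+2 in FG2 * => hpq.
  have ab0 := mulr_ge0 a0 b0.
  have d0 : 0 < (1 + a) * (1 + b) by nra.
  rewrite -(ler_pM2l d0).
  apply: (@le_trans _ _ ((1 + (a + b)) * ((1 - a) * (1 - b) * p))).
    rewrite mulrA [leRHS]mulrA ler_wpM2r//; nra.
  apply: (@le_trans _ _ ((1 + (a + b)) * ((1 + a) * (1 + b) * q))).
    by rewrite ler_wpM2l//; lra.
  by rewrite mulrCA.
Qed.

Lemma height_bounds_prod (I : finType) (P : pred I) (c : I -> R)
    (F : I -> nat -> R) :
  (forall i, P i -> 0 <= c i) -> (forall i, P i -> height_bounds (c i) (F i)) ->
  height_bounds (\sum_(i | P i) c i) (fun k => \prod_(i | P i) F i k).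
Proof.
move=> c0 cF.
suff : forall r : seq I, 0 <= \sum_(i <- r | P i) c i /\
  height_bounds (\sum_(i <- r | P i) c i) (fun k => \prod_(i <- r | P i) F i k).
  by move=> /(_ (index_enum I))[].
elim=> [|i r [ih0 ih]].
  rewrite big_nil; split=> //.
  have -> : (fun k => \prod_(i <- [::] | P i) F i k) = (fun=> 1).
    by apply/funext => k; rewrite big_nil.
  exact: height_bounds_one.
rewrite big_cons; case: ifPn => Pi.
  split; first by rewrite addr_ge0// c0.
  have -> : (fun k => \prod_(j <- i :: r | P j) F j k) =
    (fun k => F i k * \prod_(j <- r | P j) F j k).
    by apply/funext => k; rewrite big_cons Pi.
  by apply: height_bounds_mul => //; [exact: c0|exact: cF].
split=> //; have -> : (fun k => \prod_(j <- i :: r | P j) F j k) =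
    (fun k => \prod_(j <- r | P j) F j k).
  by apply/funext => k; rewrite big_cons (negbTE Pi).
exact: ih.
Qed.

(** The base case is a leaf together with the edge above it: the leaf alone has infinite conductance
    and fits no [c]. *)
Lemma height_bounds_leaf : height_bounds 1 (edge_step (fun k => (k == 0%N)%:R)).
Proof.
by split=> [] [|[|k]];
  rewrite /edge_step/= ?addr0 ?add0r ?mulr0 ?mulr1 ?subrr ?expR_ge0.
Qed.

(** The new ratio at [k] compares [F (k - 1) + F (k + 1)] with [F (k + 1) + F (k + 3)], so the outer
    terms are measured against the common [F (k + 1)]. At [k = 0] the first sum is [2 * F 1] by
    symmetry. *)
Lemma height_bounds_edge c F : 0 < c -> height_bounds c F ->
  height_bounds (c^-1 + 1)^-1 (edge_step F).
Proof.
move=> c0 [F0 FB FC FD].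
have -> : (c^-1 + 1)^-1 = c / (1 + c).
  by field; rewrite !gt_eqF//; lra.
have d0 : 0 < 1 + c by lra.
rewrite /edge_step; split=> k.
- by rewrite addr_ge0.
- have hk := @expR_edge R (c / 2) k ltac:(lra).
  set y := c / 2 in hk *.
  have eq1 : k.+1%:R * (y / (1 + 2 * y)) = c / (1 + c) * k.+1%:R / 2.
    by rewrite /y; field; lra.
  rewrite eq1 in hk.
  rewrite expRN mulrC ler_pdivlMr ?expR_gt0// mulrC.
  set E := expR (c / (1 + c) * k.+1%:R / 2) in hk *.
  have E0 : 0 <= E := expR_ge0 _.
  have hlow : expR (k%:R * y) * F k.+1 <= F (if k is j.+1 then j else 1%N).
    case: k {hk eq1 E E0} => [|k]; first by rewrite mul0r expR0 mul1r.
    have := FB k; rewrite expRN mulrC ler_pdivlMr ?expR_gt0// mulrC.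
    by have -> : k.+1%:R * y = c * k.+1%:R / 2 by rewrite /y; lra.
  have hup : F k.+3 <= expR (- (k.+2%:R * y)) * F k.+1.
    by have -> : k.+2%:R * y = c * k.+2%:R / 2 by rewrite /y; lra.
  apply: (@le_trans _ _ (E * (1 + expR (- (k.+2%:R * y))) * F k.+1)).
    by rewrite -mulrA ler_wpM2l//; lra.
  apply: (@le_trans _ _ ((1 + expR (k%:R * y)) * F k.+1)).
    by rewrite ler_wpM2r.
  by lra.
- have -> : 1 + c / (1 + c) * (5 * k%:R + 4) / 4 =
    (1 + c * (5 * k%:R + 8) / 4) / (1 + c) by field; lra.
  rewrite mulrAC ler_pdivrMr//.
  pose A : R := 1 + c * (5 * k%:R + 9) / 4.
  have k0 : 0 <= k%:R :> R by [].
  have A0 : 0 < A by rewrite /A; have := mulr_ge0 (ltW c0) k0; lra.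
  (* [B] and [A] are the old ratio bounds on the two sides of height [k + 1]. For a bound
     [1 + c * (s * k + 1)] of slope [s], both sides of the inequality agree to first order in [c]
     when [k > 0], and the second order at [k = 1] demands [(s - 1) * (2 * s + 1) <= 1], so [s] at
     most about 1.28. The choice 5/4 meets this. *)
  have [B hB hAB] : exists2 B, B * F k.+1 <= F (if k is j.+1 then j else 1%N)
      & (1 + c * (5 * k%:R + 8) / 4) * (1 + A) <= (1 + B) * (1 + c) * A.
    clear A0; rewrite {}/A; case: k k0 => [|k] k0.
      by exists 1; [rewrite mul1r|rewrite mulr0; nra].
    exists (1 + c * (5 * k%:R + 4) / 4); first exact: FC.
    rewrite -natr1; have j0 : 0 <= k%:R :> R by [].
    set J := k%:R in j0 *; have cJ := mulr_ge0 (ltW c0) j0.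
    have : 0 <= c * c * J by rewrite !mulr_ge0// ltW.
    have : 0 <= c * c * c * J by rewrite !mulr_ge0// ltW.
    have : 0 <= c * c * J * J by rewrite !mulr_ge0// ltW.
    have : 0 <= c * c * c * J * J by rewrite !mulr_ge0// ltW.
    have : 0 <= c * c by rewrite !mulr_ge0// ltW.
    have : 0 <= c * c * c by rewrite !mulr_ge0// ltW.
    nra.
  have hq : A * F k.+3 <= F k.+1.
    apply: le_trans (FC k.+1); rewrite ler_wpM2r// /A -[k.+1%:R]natr1; lra.
  have D0 : 0 <= 1 + c * (5 * k%:R + 8) / 4.
    by have := mulr_ge0 (ltW c0) k0; lra.
  rewrite -(ler_pM2l A0).
  apply: (@le_trans _ _ ((1 + c * (5 * k%:R + 8) / 4) * (1 + A) * F k.+1)).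
    have : (1 + c * (5 * k%:R + 8) / 4) * (A * F k.+3) <=
        (1 + c * (5 * k%:R + 8) / 4) * F k.+1 by rewrite ler_wpM2l.
    lra.
  apply: (@le_trans _ _ ((1 + B) * (1 + c) * A * F k.+1)).
    by rewrite ler_wpM2r.
  have : A * (1 + c) * (B * F k.+1)
      <= A * (1 + c) * F (if k is j.+1 then j else 1%N).
    by rewrite ler_wpM2l// mulr_ge0 ?ltW.
  lra.
- have -> : 1 - c / (1 + c) * k.+1%:R = (1 - c * k%:R) / (1 + c).
    by rewrite -natr1; field; lra.
  have -> : 1 + c / (1 + c) * k.+1%:R = (1 + c * k.+2%:R) / (1 + c).
    by rewrite -[k.+2%:R]natr1 -natr1; field; lra.
  rewrite mulrAC [leRHS]mulrAC ler_pM2r ?invr_gt0//.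
  (* The claim is the sum of the old bounds at [k - 1] and [k + 1], with [2 * c * F k.+1] added to
     both sides. *)
  have hu := FD k.+1.
  have hl : (1 - c * k%:R) * F (if k is j.+1 then j else 1%N)
      <= (1 + c * k%:R) * F k.+1.
    by case: k {hu} => [|k]; [rewrite mulr0 subr0 addr0|exact: FD].
  lra.
Qed.

(** Keep the elementary symmetric terms of degree at most 2 of the product. With [S] the sum of
    squares they are [1 + T + (T ^+ 2 - S) / 2], and [S <= T] because each [c i] is at most 1. *)
Lemma prod_1Dx_ge (I : finType) (P : pred I) (c : I -> R) :
  (forall i, P i -> 0 <= c i <= 1) ->
  1 + (\sum_(i | P i) c i) / 2 + (\sum_(i | P i) c i) ^+ 2 / 2 <=
  \prod_(i | P i) (1 + c i).
Proof.
move=> c01; pose K (T S Q : R) := [/\ 0 <= T, S <= T ^+ 2, S <= T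
  & 2 + 2 * T + T ^+ 2 - S <= 2 * Q].
have [T0 ST2 ST TQ] : K (\sum_(i | P i) c i) (\sum_(i | P i) c i ^+ 2)
    (\prod_(i | P i) (1 + c i)); last by lra.
apply: (big_rec3 K); first by rewrite /K expr0n/=; split=> //; lra.
move=> i t s q /c01 /andP[c0 c1] [t0 st2 st tq].
have ct : 0 <= c i * t by rewrite mulr_ge0.
have cts : 0 <= c i * (t ^+ 2 - s) by rewrite mulr_ge0// subr_ge0.
split; [lra|nra|nra|].
have : (1 + c i) * (2 + 2 * t + t ^+ 2 - s) <= (1 + c i) * (2 * q).
  by rewrite ler_wpM2l//; lra.
nra.
Qed.

(** When many branches make the total conductance large, multiplying their separate bounds [1 + c i]
    retains a quadratic term that the affine bound for the sum loses. The variance bound for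
    resistance below 1 depends on it. *)
Lemma height_prod_step2 (I : finType) (P : pred I) (c : I -> R)
    (F : I -> nat -> R) :
  (forall i, P i -> 0 <= c i <= 1) ->
  (forall i, P i -> height_bounds (c i) (F i)) ->
  (1 + (\sum_(i | P i) c i) / 2 + (\sum_(i | P i) c i) ^+ 2 / 2) *
  \prod_(i | P i) F i 2 <= \prod_(i | P i) F i 0.
Proof.
move=> c01 cF; set t := \sum_(i | P i) c i.
apply: (@le_trans _ _ (\prod_(i | P i) (1 + c i) * \prod_(i | P i) F i 2)).
  apply: ler_wpM2r; last exact: prod_1Dx_ge.
  by apply: prodr_ge0 => i /cF/height_ge0.
rewrite -big_split/=; apply: ler_prod => i Pi; have := height_poly_bound (cF i Pi) 0.
have /andP[c0 _] := c01 i Pi.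
rewrite mulr0 add0r mulfK// => ->; rewrite andbT mulr_ge0 ?addr_ge0//.
exact: height_ge0 (cF i Pi) _.
Qed.

End HeightBounds.

(** * Gaussian comparison and second moment at the root *)

Lemma cross_ratio_le (R : realType) (p q : nat -> R) (M : nat) :
  (forall n, 0 < q n) -> (forall n, (n < M)%N -> p n.+1 * q n <= p n * q n.+1) ->
  forall i j, (i <= j <= M)%N -> p j * q i <= p i * q j.
Proof.
move=> q0 pq i; elim=> [|j ih] /andP[ij jM]; first by case: i ij.
have [->//|ij'] := eqVneq i j.+1.
have {}ih : p j * q i <= p i * q j by apply: ih; lia.
rewrite -(ler_pM2r (q0 j)).
apply: (@le_trans _ _ (p j * q j.+1 * q i)).
  by rewrite mulrAC ler_pM2r ?pq.
by rewrite mulrAC [leRHS]mulrAC ler_pM2r.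
Qed.

Section RootBounds.
Variables (R : realType) (r : R) (F : nat -> R).
Hypotheses (r0 : 0 < r) (hF : height_bounds r^-1 F).

(** The exponents [(2 * i + 1) / (2 * r)] of successive ratios add up over [i < n] to
    [n ^ 2 / (2 * r)], that is [(2 * n) ^ 2 / (2 * (4 * r))]: hence the parameter 4 R. *)
Lemma height_le_gauss (i j : nat) : (i <= j)%N ->
  F j.*2 * expR (- ((i.*2)%:R ^+ 2 / (2 * (4 * r)))) <=
  F i.*2 * expR (- ((j.*2)%:R ^+ 2 / (2 * (4 * r)))).
Proof.
move=> ij.
apply: (@cross_ratio_le R (fun n => F n.*2)
  (fun n => expR (- ((n.*2)%:R ^+ 2 / (2 * (4 * r))))) j) => [n|n _|].
- exact: expR_gt0.
- rewrite doubleS.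
  rewrite -ler_pdivlMr ?expR_gt0//; apply: le_trans (height_exp_bound hF _) _.
  rewrite -[leRHS]mulrA [leRHS]mulrC ler_wpM2r ?(height_ge0 hF)//.
  rewrite -!expRN -expRD ler_expR -[n.*2.+2%:R]natr1 -[n.*2.+1%:R]natr1 opprK.
  by rewrite le_eqVlt; apply/orP; left; apply/eqP; field; rewrite gt_eqF.
- by rewrite ij /=.
Qed.

(** The truncation keeps [x = (2 * n + 1) / r] at most 1/2, where the ratio of counts is at least
    [expR (- (4 * x))]. The Gaussian weight of parameter [r / 4] drops by [expR (- (8 * x))], with a
    factor 2 to spare in the exponent. *)
Lemma gauss_le_height (i j : nat) : (i <= j)%N -> (j.*2)%:R < r / 2 ->
  expR (- ((j.*2)%:R ^+ 2 / (2 * (r / 4)))) * F i.*2 <=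
  expR (- ((i.*2)%:R ^+ 2 / (2 * (r / 4)))) * F j.*2.
Proof.
move=> ij jr; set e := fun n : nat => expR (- ((n.*2)%:R ^+ 2 / (2 * (r / 4)))).
(* [cross_ratio_le] allows a numerator of any sign, so negating [F] reverses its inequality. *)
suff : - F j.*2 * e i <= - F i.*2 * e j.
  by rewrite !mulNr lerN2 mulrC [leRHS]mulrC.
apply: (@cross_ratio_le R (fun n => - F n.*2)
  e j) => [n|n nj|].
- exact: expR_gt0.
- rewrite /e !mulNr lerN2 doubleS.
  pose x : R := n.*2.+1%:R / r.
  have x0 : 0 <= x by rewrite divr_ge0// ltW.
  have x2 : x <= 1 / 2.
    rewrite /x ler_pdivrMr// mulrC mul1r ltW// (le_lt_trans _ jr)//.
    by rewrite ler_nat; lia.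
  have hx := onem_le_expRN x0 x2.
  have := height_lower_bound hF n.*2; rewrite [r^-1 * _]mulrC -/x => hD.
  have -> : expR (- (n.*2.+2%:R ^+ 2 / (2 * (r / 4)))) =
      expR (- (8 * x)) * expR (- (n.*2%:R ^+ 2 / (2 * (r / 4)))).
    rewrite -expRD -[n.*2.+2%:R]natr1 /x -[n.*2.+1%:R]natr1; congr expR; field.
    by rewrite gt_eqF.
  suff : expR (- (8 * x)) * F n.*2 <= F n.*2.+2.
    by move=> h; rewrite mulrCA mulrA ler_wpM2r ?expR_ge0.
  have {}hx : expR (- (8 * x)) * (1 + x) <= 1 - x.
    by apply: le_trans hx; rewrite ler_wpM2r ?ler_expR//; lra.
  have x1 : 0 < 1 + x by lra.
  rewrite -(ler_pM2l x1); apply: le_trans hD.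
  by rewrite mulrA [(1 + x) * _]mulrC ler_wpM2r// (height_ge0 hF).
- by rewrite ij /=.
Qed.

(** Summation by parts with a multiplier [m]. The moment estimates differ in the choice of [m]; the
    end term vanishes there because the counts have finite support. *)
Lemma telescope_le (a u m : nat -> R) (M : nat) :
  (forall n, (a n.+1 + m n.+1) * u n.+1 <= m n * u n) ->
  \sum_(n < M) a n.+1 * u n.+1 <= m 0 * u 0 - m M * u M.
Proof.
move=> h; elim: M => [|M ih]; first by rewrite big_ord0 subrr.
rewrite big_ord_recr/=; have := h M; lra.
Qed.

(** The lower ratio bound is multiplied by [r * x] with [x = 2 * n + 1]. The coefficients then
    telescope, since [x * (r + x) - (x + 2) * (r - x - 2)] is [8 * (n + 1) ^ 2 + 2 - 2 * r]. *)
Lemma second_moment_ge (M : nat) : F M.*2 = 0 ->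
  (r - 1) * F 0 <= \sum_(n < M) (8 * n.+1%:R ^+ 2 + 2 - 2 * r) * F n.+1.*2.
Proof.
move=> FM.
have := @telescope_le (fun n => - (8 * n%:R ^+ 2 + 2 - 2 * r))
  (fun n => F n.*2) (fun n => - ((2 * n%:R + 1) * (r - 2 * n%:R - 1))) M _.
rewrite FM mulr0 subr0; under eq_bigr do rewrite mulNr.
rewrite sumrN => h.
suff /h : forall n : nat, (- (8 * n.+1%:R ^+ 2 + 2 - 2 * r) +
    - ((2 * n.+1%:R + 1) * (r - 2 * n.+1%:R - 1))) * F n.+1.*2 <=
    - ((2 * n%:R + 1) * (r - 2 * n%:R - 1)) * F n.*2.
  by rewrite double0; lra.
move=> {h} n; rewrite doubleS.
have := height_lower_bound hF n.*2.
have n0 : 0 <= n%:R :> R by [].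
have -> : n.*2.+1%:R = 2 * n%:R + 1 :> R by rewrite -natr1 -muln2 natrM mulrC.
rewrite -natr1; set x := n%:R in n0 *.
move=> h; have : r * (2 * x + 1) * ((1 - r^-1 * (2 * x + 1)) * F n.*2) <=
    r * (2 * x + 1) * ((1 + r^-1 * (2 * x + 1)) * F n.*2.+2).
  by rewrite ler_wpM2l// mulr_ge0 ?ltW//; lra.
rewrite !mulrA.
have -> : r * (2 * x + 1) * (1 - r^-1 * (2 * x + 1)) =
  (2 * x + 1) * (r - 2 * x - 1) by field; rewrite gt_eqF.
have -> : r * (2 * x + 1) * (1 + r^-1 * (2 * x + 1)) =
  (2 * x + 1) * (r + 2 * x + 1) by field; rewrite gt_eqF.
lra.
Qed.

(** The affine ratio bound fits this multiplier tightly: the step is an equality at [n = 0], and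
    with a slope [s] in place of 5/4 the remainder at [n = 1], [r = 1] would be [16 * s - 20], so
    5/4 is the least slope that works. *)
Lemma second_moment_le_ge1 (M : nat) : 1 <= r -> F M.*2 = 0 ->
  \sum_(n < M) (8 * n.+1%:R ^+ 2 - 8 * r) * F n.+1.*2 <= 4 * r * F 0.
Proof.
move=> r1 FM.
have := @telescope_le (fun n => 8 * n%:R ^+ 2 - 8 * r)
  (fun n => F n.*2) (fun n => 4 * r * (2 * n%:R + 1) - 4 * n%:R) M _.
rewrite FM /= !(mulr0, subr0, add0r, mulr1) => -> // n.
rewrite doubleS.
have n0 : 0 <= n%:R :> R by [].
have := height_poly_bound hF n.*2.
have -> : n.*2%:R = 2 * n%:R :> R by rewrite -muln2 natrM mulrC.
rewrite -natr1; set x := n%:R in n0 *.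
set p := F n.*2; set q := F n.*2.+2 => h.
have q0 : 0 <= q by exact: height_ge0 hF _.
have rx : 0 <= (r - 1) * x by rewrite mulr_ge0//; lra.
have m0 : 0 <= 4 * r * (2 * x + 1) - 4 * x by nra.
apply: le_trans (ler_wpM2l m0 h); rewrite [leRHS]mulrA ler_wpM2r// -subr_ge0.
rewrite [leRHS](_ : _ = (r * (12 * x ^+ 2 + 2 * x) - 2 * x * (5 * x + 2)) / r);
  last by field; rewrite gt_eqF.
apply: divr_ge0; last exact: ltW.
have [xE|n1] := posnP n; first by rewrite /x xE !mulr0 expr0n/= !mulr0 mul0r addr0 mulr0 subrr.
have x1 : 1 <= x by rewrite /x ler1n.
have : (12 * x ^+ 2 + 2 * x) <= r * (12 * x ^+ 2 + 2 * x).
  by rewrite ler_peMl//; nra.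
nra.
Qed.

Lemma second_moment_le_le1 (M : nat) : r <= 1 -> F M.*2 = 0 ->
  (1 + r^-1 / 2 + r^-1 ^+ 2 / 2) * F 2 <= F 0 ->
  \sum_(n < M) (8 * n.+1%:R ^+ 2 - 8 * r) * F n.+1.*2 <= 4 * r * F 0.
Proof.
move=> r1 FM h2.
(* With multiplier [t * r] after the first index, the first step leaves
   [((12 - t) * r ^+ 2 - 6 * r + 2) / r]. The largest [t] keeping the numerator nonnegative for
   every [r] is 15/2, where it is half the square [(3 * r - 2) ^+ 2]. *)
have := @telescope_le (fun n => 8 * n%:R ^+ 2 - 8 * r)
  (fun n => F n.*2) (fun n => if n == 0%N then 4 * r else 15 / 2 * r) M _.
rewrite FM mulr0 subr0 /= => -> // [|n] /=.
  rewrite -[F 0.*2]/(F 0) -[F 1.*2]/(F 2).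
  set p := F 0 in h2 *; set q := F 2 in h2 *.
  have q0 : 0 <= q by exact: height_ge0 hF _.
  apply: (@le_trans _ _ (4 * r * ((1 + r^-1 / 2 + r^-1 ^+ 2 / 2) * q))); last first.
    by rewrite ler_wpM2l// mulr_ge0// ltW.
  rewrite [leRHS]mulrA ler_wpM2r// -subr_ge0.
  rewrite [leRHS](_ : _ = (3 * r - 2) ^+ 2 / (2 * r));
    last by field; rewrite gt_eqF.
  by rewrite divr_ge0 ?sqr_ge0// mulr_ge0// ltW.
have := height_exp_bound hF n.+1.*2.
rewrite expRN -ler_pdivrMl ?invr_gt0 ?expR_gt0// invrK.
rewrite -[n.+2.*2]/(n.+1.*2.+2).
set p := F n.+1.*2; set q := F n.+1.*2.+2 => h.
have q0 : 0 <= q by exact: height_ge0 hF _.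
have nE : n.+1.*2.+1%:R = 2 * n%:R + 3 :> R.
  by rewrite doubleS -!natr1 -muln2 natrM; lra.
rewrite nE in h; rewrite -[n.+2%:R]natr1 -natr1.
have n0 : 0 <= n%:R :> R by [].
set x := n%:R in h n0 *; set z := r^-1 * (2 * x + 3) / 2 in h.
have zr : z * r = x + 3 / 2 by rewrite /z; field; rewrite gt_eqF.
have z32 : 3 / 2 <= z.
  rewrite -(ler_pM2r r0) zr; lra.
have := expR_ge_quadratic z32; set E := expR z in h * => hE.
apply: (@le_trans _ _ (15 / 2 * r * (E * q))); last first.
  by rewrite ler_wpM2l// mulr_ge0// ltW.
rewrite [leRHS]mulrA ler_wpM2r//.
(* At [r = 1], where [z = x + 3 / 2], this quadratic is exactly the required coefficient
   [8 * (x + 2) ^+ 2 - 1 / 2]; a smaller [r] makes [z] larger and leaves room. *)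
apply: (@le_trans _ _ (r * (8 * z ^+ 2 + 8 * z + 3 / 2))).
  have -> : r * (8 * z ^+ 2 + 8 * z + 3 / 2) =
    8 * z * (z * r) + 8 * (z * r) + 3 / 2 * r by ring.
  rewrite zr.
  have za : z - (x + 3 / 2) = z * (1 - r) by rewrite mulrBr mulr1 zr.
  have h1r : 0 <= 1 - r by lra.
  have : 9 / 4 * (1 - r) <= (x + 3 / 2) * (z * (1 - r)).
    rewrite mulrA ler_wpM2r//; nra.
  rewrite -za; nra.
by rewrite mulrAC [leRHS]mulrC ler_wpM2l// ltW.
Qed.

End RootBounds.

(** * Proportional laws, their levels and stochastic comparison *)

Section Esum.
Local Open Scope ereal_scope.
Variables (R : realType) (T : choiceType).
Implicit Types (I : set T) (a : T -> \bar R).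

Lemma ge0_esumZl (c : R) I a : (0 <= c)%R -> (forall x, 0 <= a x) ->
  \esum_(x in I) (c%:E * a x) = c%:E * \esum_(x in I) a x.
Proof.
move=> c0 a0.
have esumZ_le (k : R) (b : T -> \bar R) : (0 <= k)%R -> (forall x, 0 <= b x) ->
    \esum_(x in I) (k%:E * b x) <= k%:E * \esum_(x in I) b x.
  move=> k0 b0; rewrite ge_ereal_sup//= => _ [X [finX XI] <-].
  rewrite -ge0_mule_fsumr//.
  by apply: lee_wpmul2l; [rewrite lee_fin|apply: esum_ge; exists X].
apply/eqP; rewrite eq_le esumZ_le//=.
have [->|cn0] := eqVneq c 0%R.
  by rewrite mul0e; apply: esum_ge0 => x _; rewrite mul0e.
have cgt0 : (0 < c)%R by rewrite lt_neqAle eq_sym cn0.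
rewrite -lee_pdivlMl//.
rewrite [leLHS](_ : _ = \esum_(x in I) (c^-1%:E * (c%:E * a x))).
  by apply: esumZ_le; [rewrite invr_ge0|move=> x; rewrite mule_ge0].
by apply: eq_esum => x _; rewrite muleA -EFinM mulVf// mul1e.
Qed.

End Esum.

Section Levels.
Local Open Scope ereal_scope.
Variables (R : realType) (X : zmodType) (w : X -> R).
Variables (w_ge0 : forall x, (0 <= w x)%R) (K : X -> nat) (a : nat -> R).
Hypothesis level : forall n,
  weight_measure w_ge0 [set x | K x = n] = (a n)%:E.

Lemma level_ge0 n : (0 <= a n)%R.
Proof. by rewrite -lee_fin -level; apply: esum_ge0 => x _; rewrite lee_fin. Qed.

Lemma weight_measure_levels (B : set nat) :
  weight_measure w_ge0 [set x | B (K x)] = \esum_(n in B) (a n)%:E.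
Proof.
under [RHS]eq_esum do rewrite -level.
rewrite /weight_measure -esum_bigcupT; last 2 first.
- by move=> i j _ _ [x [/= -> ->]].
- by move=> x; rewrite lee_fin.
congr esum; apply/seteqP; split=> x /=; first by move=> Bx; exists (K x).
by move=> [n Bn /= ->].
Qed.

Variable m : R.
Hypotheses (m_gt0 : (0 < m)%R) (total : \esum_(n in setT) (a n)%:E = m%:E).

Lemma proportional_lawE (A : set X) :
  proportional_law w_ge0 A = weight_measure w_ge0 A * (m^-1)%:E.
Proof.
rewrite /proportional_law /= /mnormalize.
have mT : weight_measure w_ge0 [set: X] = m%:E.
  by rewrite -total -weight_measure_levels.
rewrite -[X in if X then _ else _]/((weight_measure w_ge0 [set: X] == 0) ||
  (weight_measure w_ge0 [set: X] == +oo)) mT eqe gt_eqF//=.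
rewrite -[weight_measure w_ge0 [set: discrete X]]/(weight_measure w_ge0 [set: X]).
by rewrite mT.
Qed.

Lemma proportional_law_levels (B : set nat) :
  proportional_law w_ge0 [set x | B (K x)] =
  (\esum_(n in B) (a n)%:E) * (m^-1)%:E.
Proof. by rewrite proportional_lawE weight_measure_levels. Qed.

End Levels.

Section LevelComparison.
Local Open Scope ereal_scope.
Variable R : realType.

(** Likelihood ratio order implies stochastic order: summing the cross inequalities over [j] in [B]
    and [i] outside gives [sa * tb <= ta * sb], which compares the normalised masses of [B]. *)
Lemma esum_up_le (a b : nat -> R) (ma mb : R) (B : set nat) :
  (forall n, 0 <= a n)%R -> (forall n, 0 <= b n)%R -> (0 < ma)%R -> (0 < mb)%R ->
  \esum_(n in setT) (a n)%:E = ma%:E -> \esum_(n in setT) (b n)%:E = mb%:E ->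
  (forall i j, B j -> ~ B i -> a j * b i <= a i * b j)%R ->
  (\esum_(n in B) (a n)%:E) * (ma^-1)%:E <=
  (\esum_(n in B) (b n)%:E) * (mb^-1)%:E.
Proof.
move=> a0 b0 ma0 mb0 aT bT ab.
have split_sum (c : nat -> R) (mc : R) : (forall n, 0 <= c n)%R ->
    \esum_(n in setT) (c n)%:E = mc%:E -> exists s t : R, [/\ (0 <= s)%R,
      \esum_(n in B) (c n)%:E = s%:E,
      \esum_(n in ~` B) (c n)%:E = t%:E & mc = (s + t)%R].
  move=> c0; rewrite (esumID B); last by move=> n _; rewrite lee_fin.
  rewrite !setTI.
  have : 0 <= \esum_(n in B) (c n)%:E.
    by apply: esum_ge0 => n _; rewrite lee_fin.
  have : 0 <= \esum_(n in ~` B) (c n)%:E.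
    by apply: esum_ge0 => n _; rewrite lee_fin.
  case: (esum _ _) => [t||] //; case: (esum _ _) => [s||] //.
  by rewrite !lee_fin => t0 s0 [<-]; exists s, t.
have [sa [ta [sa0 saE taE maE]]] := split_sum a ma a0 aT.
have [sb [tb [sb0 sbE tbE mbE]]] := split_sum b mb b0 bT.
have key : (sa * tb <= ta * sb)%R.
  rewrite -lee_fin !EFinM -tbE -taE [leRHS]muleC -!ge0_esumZl//.
  apply: le_esum => i Bi; rewrite [leLHS]muleC [leRHS]muleC -saE -sbE.
  rewrite -!ge0_esumZl//.
  by apply: le_esum => j Bj; rewrite -!EFinM lee_fin mulrC ab.
rewrite saE sbE -!EFinM lee_fin ler_pdivrMr// mulrAC ler_pdivlMr// maE mbE.
lra.
Qed.

End LevelComparison.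

(** * Absolute values and summability of Gaussian weights *)

Section GaussianLevels.
Variable R : realType.

Definition fiber_size (n : nat) : nat := if n is 0 then 1 else 2.

Lemma weight_measure_absz (w : int -> R) (w_ge0 : forall x, 0 <= w x) :
  (forall x, w (- x) = w x) -> forall n,
  weight_measure w_ge0 [set x | `|x|%N = n] = (w n%:Z *+ fiber_size n)%:E.
Proof.
move=> wN [|n]; rewrite /weight_measure/=.
  rewrite (_ : [set x : int | _] = [set 0]).
    by rewrite esum_set1// lee_fin.
  apply/seteqP; split=> x /=; last by move=> ->.
  by move/eqP; rewrite absz_eq0 => /eqP.
rewrite (_ : [set x : int | _] = [set Posz n.+1; Negz n]).
  rewrite esum_fset//; last by move=> x _; rewrite lee_fin.
  rewrite fsbigU//=; last by move=> x /= [->].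
  by rewrite !fsbig_set1 NegzE wN mulr2n.
apply/seteqP; split=> x /=; last by case=> ->.
by case: x => k /= kn; [left; rewrite kn|right; case: kn => ->].
Qed.

Lemma gauss_weight_even (s2 : R) (n : nat) :
  gauss_weight evenZ s2 n%:Z =
  if odd n then 0 else expR (- (n%:R ^+ 2 / (2 * s2))).
Proof.
rewrite /gauss_weight indicE; have -> : ((n%:Z : int) \in evenZ) = ~~ odd n.
  by apply/idP/idP; rewrite inE /evenZ/= => ?; lia.
by case: (odd n); rewrite ?mul0r ?mul1r.
Qed.

Lemma esum_gauss_lty (s2 : R) (g : nat -> R) : 0 < s2 ->
  (forall n, 0 <= g n <= expR (- (n%:R ^+ 2 / (2 * s2))) *+ fiber_size n) ->
  (\esum_(n in setT) (g n)%:E < +oo)%E.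
Proof.
move=> s0 hg.
pose q := expR (- (2 * s2)^-1).
have q0 : 0 < q by exact: expR_gt0.
have q1 : q < 1 by rewrite expR_lt1 oppr_lt0 invr_gt0 mulr_gt0.
apply: (@le_lt_trans _ _ (2 / (1 - q))%:E); last exact: ltry.
rewrite -nneseries_esumT; last by move=> n; rewrite lee_fin; case/andP: (hg n).
apply: lime_le.
  by apply: is_cvg_nneseries => n _ _; rewrite lee_fin; case/andP: (hg n).
apply: nearW => N; rewrite sumEFin lee_fin.
have hq n : g n <= 2 * q ^+ n.
  have /andP[_ /le_trans->//] := hg n.
  apply: (@le_trans _ _ (expR (- (n%:R ^+ 2 / (2 * s2))) *+ 2)).
    by apply: ler_wpMn2l; [exact: expR_ge0|case: n].
  rewrite -[leLHS]mulr_natl ler_wpM2l// /q -expRM_natl ler_expR mulrN lerN2.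
  rewrite ler_pM2r ?invr_gt0 ?mulr_gt0// -natrX ler_nat.
  by case: n => // n; rewrite expnS leq_pmulr.
apply: (@le_trans _ _ (\sum_(0 <= n < N) 2 * q ^+ n)).
  by apply: ler_sum => n _.
rewrite -mulr_sumr ler_wpM2l// -[leRHS]mul1r ler_pdivlMr ?subr_gt0//.
rewrite big_mkord; elim: N => [|N]; first by rewrite big_ord0 mul0r.
have qN : 0 <= q ^+ N by rewrite exprn_ge0// ltW.
rewrite big_ord_recr/= => h.
suff : (\sum_(i < N) q ^+ i) * (1 - q) = 1 - q ^+ N.
  move=> e; rewrite mulrDl e; nra.
elim: N {h qN} => [|N ih]; first by rewrite big_ord0 mul0r expr0 subrr.
by rewrite big_ord_recr/= mulrDl ih exprS; ring.
Qed.

End GaussianLevels.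

(** * Distances, parents and children in a tree *)

Section TreeStructure.
Variables (V : finType) (e : rel V) (root : V).

Local Notation dist := (dist e root).
Local Notation child := (child e root).
Local Notation leaves := (leaves e root).

Lemma walkP n x y :
  reflect (exists p : seq V, [/\ path e x p, last x p = y & size p = n])
    (walk e n x y).
Proof.
apply: (iffP existsP) => [[p /andP[ep /eqP lp]]|[p [ep lp sp]]].
  by exists p; rewrite size_tuple.
by exists (tcast sp (in_tuple p)); rewrite val_tcast ep lp eqxx.
Qed.

Lemma walk_dist_le n y : walk e n root y -> (dist y <= n)%N.
Proof.
move=> wn; rewrite leqNgt; apply/negP => ny.
have nV : (n < #|V|)%N.
  by apply: leq_trans ny _; rewrite /Defs.dist -[X in (_ <= X)%N](size_iota 0) find_size.
by have := before_find 0%N ny; rewrite nth_iota// add0n wn.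
Qed.

Lemma dist_root : dist root = 0%N.
Proof. by apply/eqP; rewrite -leqn0; apply: walk_dist_le; apply/walkP; exists [::]. Qed.

Hypothesis tree_e : is_tree e.

Let e_sym : symmetric e. Proof. by case: tree_e. Qed.
Let e_irr : irreflexive e. Proof. by case: tree_e. Qed.

Lemma dist_lt_card y : (dist y < #|V|)%N.
Proof.
have [_ _ /(_ root y)/connectP[p ep ->] _] := tree_e.
case/shortenP: ep => p' ep' up' _; apply: (@leq_ltn_trans (size p')).
  by apply: walk_dist_le; apply/walkP; exists p'.
by rewrite -[(_ < _)%N]/(size (root :: p') <= #|V|)%N -(card_uniqP up') max_card.
Qed.

Lemma walk_dist y : walk e (dist y) root y.
Proof.
have := dist_lt_card y; rewrite /Defs.dist -[X in (_ < X)%N](size_iota 0) -has_find.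
by move=> h; have := nth_find 0%N h; rewrite nth_iota// -[X in (_ < X)%N](size_iota 0) -has_find.
Qed.

Lemma dist_step x y : e x y -> (dist y <= (dist x).+1)%N.
Proof.
move=> exy; apply: walk_dist_le; have /walkP[p [ep lp sp]] := walk_dist x.
by apply/walkP; exists (rcons p y); rewrite rcons_path ep lp exy last_rcons size_rcons sp.
Qed.

Lemma has_parent x : x != root -> exists2 y, e y x & dist x = (dist y).+1.
Proof.
move=> xr; have /walkP[p [ep lp sp]] := walk_dist x.
case/lastP: p ep lp sp => [|p z]; first by move=> _ /esym/eqP; rewrite (negbTE xr).
rewrite rcons_path last_rcons size_rcons => /andP[ep ez] zx sp; subst z.
exists (last root p) => //; apply/eqP; rewrite eqn_leq dist_step//= -sp ltnS.
by apply: walk_dist_le; apply/walkP; exists p.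
Qed.

Lemma child_dist v w : child v w -> dist w = (dist v).+1.
Proof. by case/andP => _ /eqP. Qed.

Lemma child_edge v w : child v w -> e v w.
Proof. by case/andP. Qed.

(** A detour around the edge, made simple, closes with it into a cycle. Acyclicity makes the cycle
    so short that the detour is the deleted edge itself. *)
Lemma bridge a b : e a b ->
  ~~ connect [rel x y | e x y && ((x, y) \notin [:: (a, b); (b, a)])] a b.
Proof.
move=> eab; apply/negP => /connectP[p ep lp].
have [_ _ _ acy] := tree_e.
case/shortenP: ep lp => p' ep' up' _ lp.
have ab : a != b by apply: contraTneq eab => ->; rewrite e_irr.
have : (size (a :: p') < 3)%N.
  apply: acy; rewrite /ucycle up' andbT /= rcons_path -lp e_sym eab andbT.
  by apply: sub_path ep' => x y /andP[].
case: p' ep' up' lp => [|c [|d p']] //=; first by move=> _ _ ba; rewrite ba eqxx in ab.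
by move=> /andP[/andP[_ h] _] _ bc; rewrite bc !inE eqxx in h.
Qed.

(** Going from parent to parent only decreases the distance, whereas using the edge between [a] and
    [b] would mean leaving its farther end. *)
Lemma connect_root_below a b x : (dist x < maxn (dist a) (dist b))%N ->
  connect [rel x y | e x y && ((x, y) \notin [:: (a, b); (b, a)])] x root.
Proof.
move: {2}(dist x) (leqnn (dist x)) => n; elim: n x => [|n ih] x xn xab.
  have [->//|/has_parent[y _ xy]] := eqVneq x root.
  by rewrite xy in xn.
have [->//|/has_parent[y eyx xy]] := eqVneq x root.
apply: (@connect_trans _ _ y); last by apply: ih; lia.
apply: connect1; rewrite /= e_sym eyx/= !inE !xpair_eqE negb_or.
apply/andP; split; apply/negP => /andP[/eqP xe /eqP ye]; subst.
  by move: xab; lia.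
by move: xab; lia.
Qed.

Lemma dist_edge x y : e x y -> dist x <> dist y.
Proof.
move=> exy dxy; have /negP := bridge exy; apply.
pose e' := [rel u v | e u v && ((u, v) \notin [:: (x, y); (y, x)])].
have e's : connect_sym e'.
  apply: sym_connect_sym => u v /=; rewrite e_sym; congr (_ && ~~ _).
  by rewrite !inE !xpair_eqE orbC; congr (_ || _); rewrite andbC.
have down z : z = x \/ z = y -> connect e' z root.
  move=> zxy; have [->//|zr] := eqVneq z root.
  have [u euz zu] := has_parent zr.
  apply: (@connect_trans _ _ u); last first.
    by apply: connect_root_below; case: zxy => ze; subst z; lia.
  apply: connect1; rewrite /= e_sym euz !inE !xpair_eqE/=.
  apply/negP => /orP[] /andP[/eqP ze /eqP ue]; subst; lia.
apply: (@connect_trans _ _ root); first by apply: down; left.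
by rewrite e's; apply: down; right.
Qed.

Lemma parent_unique x y v : child x v -> child y v -> x = y.
Proof.
move=> /andP[exv /eqP vx] /andP[eyv /eqP vy]; apply/eqP/negP => /negP xy.
have /negP := bridge exv; apply.
pose e' := [rel u w | e u w && ((u, w) \notin [:: (x, v); (v, x)])].
have e's : connect_sym e'.
  apply: sym_connect_sym => u w /=; rewrite e_sym; congr (_ && ~~ _).
  by rewrite !inE !xpair_eqE orbC; congr (_ || _); rewrite andbC.
apply: (@connect_trans _ _ root); first by apply: connect_root_below; lia.
rewrite e's; apply: (@connect_trans _ _ y); last by apply: connect_root_below; lia.
apply: connect1; rewrite /= e_sym eyv/= !inE !xpair_eqE.
apply/negP => /orP[] /andP[/eqP ue /eqP we]; subst; last by rewrite eqxx in xy.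
by move: vx; lia.
Qed.

Definition parent (w : V) : V := odflt root [pick v | child v w].

Lemma child_parent v w : child v w -> parent w = v.
Proof.
rewrite /parent => vw; case: pickP => [u uw|/(_ v)]; last by rewrite vw.
exact: parent_unique uw vw.
Qed.

Lemma child_neq_root v w : child v w -> w != root.
Proof. by move=> /child_dist h; apply: contra_eq_neq h => ->; rewrite dist_root. Qed.

Lemma parentP w : w != root -> child (parent w) w.
Proof.
move=> /has_parent[v evw wv]; have vw : child v w by rewrite /Defs.child evw wv eqxx.
by rewrite (child_parent vw).
Qed.

Lemma childE v w : child v w = (w != root) && (parent w == v).
Proof.
apply/idP/andP => [vw|[wr /eqP <-]]; last exact: parentP.
by rewrite (child_neq_root vw) (child_parent vw).
Qed.

Lemma edgeE v w : e v w = child v w || child w v.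
Proof.
apply/idP/orP => [evw|[/child_edge//|/child_edge]]; last by rewrite e_sym.
rewrite /Defs.child evw e_sym evw /=.
have := dist_step evw; have := dist_edge evw.
have := dist_step (etrans (e_sym w v) evw); lia.
Qed.

Lemma child_asym v w : child v w -> child w v = false.
Proof. by move=> /child_dist vw; apply/negP => /child_dist; lia. Qed.

Lemma leafN v : v \in leaves -> forall w, child v w = false.
Proof. by rewrite inE => /forallP h w; apply/negbTE. Qed.

Lemma nonleaf v : v \notin leaves -> exists w, child v w.
Proof. by rewrite inE => /forallPn[w]; rewrite negbK => vw; exists w. Qed.

Lemma tree_ind (P : V -> Prop) :
  (forall v, (forall w, child v w -> P w) -> P v) -> forall v, P v.
Proof.
move=> ih v; move: {2}(#|V| - dist v)%N (leqnn (#|V| - dist v)) => n.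
elim: n v => [|n IH] v hv; apply: ih => w vw; have := dist_lt_card v;
  have := child_dist vw => ? ?; first by lia.
by apply: IH; lia.
Qed.

End TreeStructure.

(** * Effective resistance by the series and parallel laws *)

Section TreeRecursion.
Variables (R : realType) (V : finType) (e : rel V) (root : V).
Hypothesis tree_e : is_tree e.

Local Notation dist := (dist e root).
Local Notation child := (child e root).
Local Notation leaves := (leaves e root).
Local Notation parent := (parent e root).

(** At a leaf the sum is empty and the convention [0^-1 = 0] yields the correct resistance 0. *)
Fixpoint subtree_resistance_rec (n : nat) (v : V) : R :=
  if n is n'.+1 then (\sum_(w | child v w) (subtree_resistance_rec n' w + 1)^-1)^-1
  else 0.

(* The fuel #|V| - dist v decreases by exactly one from a vertex to a child. *)
Definition subtree_resistance (v : V) : R :=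
  subtree_resistance_rec (#|V| - dist v) v.

Local Notation res := subtree_resistance.

Definition branch_conductance (v : V) : R := (res v + 1)^-1.

Local Notation cond := branch_conductance.

Lemma subtree_resistanceE v : res v = (\sum_(w | child v w) cond w)^-1.
Proof.
rewrite /cond /res; have hv := dist_lt_card root tree_e v.
have -> : (#|V| - dist v)%N = (#|V| - (dist v).+1).+1 by lia.
by congr (_^-1); apply: eq_bigr => w /child_dist ->.
Qed.

Lemma subtree_resistance_ge0 v : 0 <= res v.
Proof.
elim/(tree_ind (root := root) tree_e): v => v ih; rewrite subtree_resistanceE.
rewrite invr_ge0 sumr_ge0// => w vw.
by rewrite invr_ge0 addr_ge0// ih.
Qed.

Lemma branch_conductance_gt0 v : 0 < cond v.
Proof. by rewrite invr_gt0 ltr_wpDl// subtree_resistance_ge0. Qed.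

Lemma branch_conductance_le1 v : cond v <= 1.
Proof. by rewrite invf_le1 ?lerDr ?subtree_resistance_ge0// ltr_wpDl// subtree_resistance_ge0. Qed.

Lemma subtree_resistance_leaf v : v \in leaves -> res v = 0.
Proof.
by move=> /leafN vl; rewrite subtree_resistanceE big_pred0 ?invr0.
Qed.

Lemma branch_conductance_sum_gt0 v :
  v \notin leaves -> 0 < \sum_(w | child v w) cond w.
Proof.
move=> /nonleaf[w vw]; rewrite (bigD1 w)//= ltr_pwDl ?branch_conductance_gt0//.
by apply: sumr_ge0 => u _; rewrite ltW ?branch_conductance_gt0.
Qed.

Lemma subtree_resistance_gt0 v : v \notin leaves -> 0 < res v.
Proof. by move=> vl; rewrite subtree_resistanceE invr_gt0 branch_conductance_sum_gt0. Qed.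

Lemma sum_neighbours (v : V) (G : V -> R) :
  \sum_w (e v w)%:R * G w =
  \sum_(w | child v w) G w + (v != root)%:R * G (parent v).
Proof.
rewrite [X in X + _]big_mkcond/=.
have -> : (v != root)%:R * G (parent v) = \sum_w (child w v)%:R * G w.
  rewrite (bigD1 (parent v))//= childE// eqxx andbT big1 ?addr0// => w wv.
  by rewrite childE// [_ == w]eq_sym (negbTE wv) andbF mul0r.
rewrite -big_split/=; apply: eq_bigr => w _; rewrite (edgeE root tree_e).
case: ifP => [vw|_] /=; last by rewrite add0r.
by rewrite (child_asym vw) mul0r addr0 mul1r.
Qed.

Section Collapse.

Local Notation node := (option {v : V | v \notin leaves}).
Local Notation col := (@collapse V leaves).
Local Notation cc := (@collapsed_conductance R V e leaves).

Lemma collapse_None v : (col v == None) = (v \in leaves).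
Proof.
by rewrite /collapse; case: insubP => [u vl _|]; [rewrite (negbTE vl)|rewrite negbK => ->].
Qed.

Lemma collapse_eq u v : v \notin leaves -> (col u == col v) = (u == v).
Proof.
move=> vl; apply/eqP/eqP => [|->//]; rewrite /collapse.
case: insubP => [u' _ <-|_]; case: insubP => [v' _ <-|] //; last by rewrite vl.
by case=> ->.
Qed.

Lemma collapse_current (h : node -> R) (x : node) :
  \sum_y cc x y * (h x - h y) =
  \sum_(u | col u == x) \sum_w (e u w)%:R * (h (col u) - h (col w)).
Proof.
rewrite /collapsed_conductance.
under eq_bigr do rewrite mulr_suml.
rewrite exchange_big/=; apply: eq_bigr => u /eqP <-.
rewrite [RHS](partition_big col predT)//=; apply: eq_bigr => y _.
by rewrite mulr_suml; apply: eq_bigr => w /eqP <-.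
Qed.

Lemma collapse_current_nonleaf (h : node -> R) v : v \notin leaves ->
  \sum_y cc (col v) y * (h (col v) - h y) =
  \sum_(w | child v w) (h (col v) - h (col w)) +
  (v != root)%:R * (h (col v) - h (col (parent v))).
Proof.
move=> vl; rewrite collapse_current (eq_bigl (pred1 v)); last first.
  by move=> u /=; rewrite collapse_eq.
by rewrite big_pred1_eq sum_neighbours.
Qed.

(** Uniqueness of the voltage. From the leaves up, the current entering a child [w] equals the one
    leaving it, so the drop from its parent to the leaves is [res w + 1] times the current in the
    edge. At the root the total current is 1. *)
Lemma potential_drop (h : node -> R) :
  unit_current_potential cc (col root) None h ->
  h (col root) - h None = res root.
Proof.
move=> hh.
have drop v : v \notin leaves ->
    h (col v) - h None = res v * \sum_(w | child v w) (h (col v) - h (col w)).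
  elim/(tree_ind (root := root) tree_e): v => v ih vl.
  have -> : \sum_(w | child v w) (h (col v) - h (col w)) =
      (\sum_(w | child v w) cond w) * (h (col v) - h None).
    rewrite mulr_suml; apply: eq_bigr => w vw.
    have r1 : res w + 1 != 0 by rewrite gt_eqF// ltr_wpDl// subtree_resistance_ge0.
    rewrite /cond; apply: (mulfI r1); rewrite mulrA mulfV// mul1r.
    have [wl|wl] := boolP (w \in leaves).
      rewrite subtree_resistance_leaf// add0r mul1r.
      by move: wl; rewrite -collapse_None => /eqP ->.
    have := hh (col w); rewrite collapse_current_nonleaf// collapse_None.
    rewrite (negbTE wl) subr0 (child_neq_root vw) (child_parent tree_e vw) mul1r.
    have -> : (col w == col root) = false.
      by rewrite eq_sym collapse_eq// eq_sym (negbTE (child_neq_root vw)).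
    move=> /eqP; rewrite addr_eq0 => /eqP wE.
    have := ih w vw wl; rewrite wE; lra.
  rewrite mulrA subtree_resistanceE mulVf ?mul1r//.
  by rewrite gt_eqF// branch_conductance_sum_gt0.
have [rl|rl] := boolP (root \in leaves).
  rewrite subtree_resistance_leaf//.
  by move: rl; rewrite -collapse_None => /eqP ->; rewrite subrr.
rewrite drop//; have := hh (col root).
rewrite collapse_current_nonleaf// collapse_None (negbTE rl) !eqxx mul0r addr0 subr0.
by move=> ->; rewrite mulr1.
Qed.

(** Existence of a potential, built as a voltage divider: a vertex [w] keeps the fraction
    [res w / (res w + 1)] of its parent's voltage. *)
Fixpoint tree_potential_rec (n : nat) (v : V) : R :=
  if n is n'.+1 then tree_potential_rec n' (parent v) * (res v * cond v)
  else res root.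

Definition tree_potential (v : V) : R := tree_potential_rec (dist v) v.

Lemma tree_potential_root : tree_potential root = res root.
Proof. by rewrite /tree_potential dist_root. Qed.

Lemma tree_potential_child v w : child v w ->
  tree_potential w = tree_potential v * (res w * cond w).
Proof.
move=> vw; rewrite /tree_potential (child_dist vw) /=.
by rewrite (child_parent tree_e vw).
Qed.

Lemma tree_potential_leaf v : v \in leaves -> tree_potential v = 0.
Proof.
move=> vl; have [vr|vr] := eqVneq v root.
  by rewrite vr tree_potential_root -vr subtree_resistance_leaf.
rewrite (tree_potential_child (parentP tree_e vr)) subtree_resistance_leaf//.
by rewrite mul0r mulr0.
Qed.

Definition node_potential (x : node) : R :=
  if x is Some v then tree_potential (val v) else 0.

Lemma node_potentialE v : node_potential (col v) = tree_potential v.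
Proof.
rewrite /node_potential /collapse; case: insubP => [u _ ->//|].
by rewrite negbK => /tree_potential_leaf.
Qed.

Lemma node_potential_current :
  unit_current_potential cc (col root) None node_potential.
Proof.
have node v : v \notin leaves ->
    \sum_y cc (col v) y * (node_potential (col v) - node_potential y) =
    (v == root)%:R.
  move=> vl; rewrite collapse_current_nonleaf//.
  have -> : \sum_(w | child v w)
      (node_potential (col v) - node_potential (col w)) = tree_potential v / res v.
    rewrite subtree_resistanceE invrK mulr_sumr; apply: eq_bigr => w vw.
    rewrite !node_potentialE (tree_potential_child vw) /cond.
    by field; rewrite gt_eqF// ltr_wpDl// subtree_resistance_ge0.
  have rv := subtree_resistance_gt0 vl.
  have [vr|vr] := eqVneq v root.
    by rewrite mul0r addr0 vr tree_potential_root divff// -vr gt_eqF.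
  rewrite mul1r !node_potentialE /=.
  rewrite (tree_potential_child (parentP tree_e vr)) /cond.
  by field; rewrite !gt_eqF// addr_gt0.
have Some_eq x : x != None ->
    \sum_y cc x y * (node_potential x - node_potential y) = (x == col root)%:R.
  case: x => // -[v vl] _; have <- : col v = Some (exist _ v vl).
    by rewrite /collapse insubT.
  by rewrite node// [col v == _]eq_sym collapse_eq// eq_sym.
move=> x; have [->|xN] := eqVneq x None; last by rewrite Some_eq// subr0.
(* Kirchhoff's law at the collapsed leaves follows from the other nodes, since all currents cancel
   in pairs. *)
have tot : \sum_x \sum_y cc x y * (node_potential x - node_potential y) = 0.
  have ccC x' y' : cc x' y' = cc y' x'.
    rewrite /collapsed_conductance exchange_big/=.
    apply: eq_bigr => u _; apply: eq_bigr => w _.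
    by case: tree_e => es _ _ _; rewrite es.
  set S := LHS; suff : S = - S by move=> h; lra.
  rewrite {1}/S exchange_big/= -sumrN; apply: eq_bigr => x' _.
  rewrite -sumrN; apply: eq_bigr => y' _.
  by rewrite ccC -mulrN opprB.
move: tot; rewrite (bigD1 None)//=.
under [X in _ + X]eq_bigr do rewrite Some_eq//.
have : \sum_x (x == col root)%:R = 1 :> R.
  by rewrite (bigD1 (col root))//= eqxx big1 ?addr0// => y /negbTE ->.
rewrite (bigD1 None)//= => hs ht; rewrite /=; lra.
Qed.

Lemma leaf_resistanceE : leaf_resistance R e root = res root.
Proof.
rewrite /leaf_resistance /effective_resistance; apply: xget_unique.
  exists node_potential; split; first exact: node_potential_current.
  exact/esym/potential_drop/node_potential_current.
by move=> _ [h [hh ->]]; exact: potential_drop.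
Qed.

End Collapse.
End TreeRecursion.

(** * Counting homomorphisms along the tree *)

Section Counting.
Variables (R : realType) (V : finType) (e : rel V) (root : V).
Hypothesis tree_e : is_tree e.

Local Notation dist := (dist e root).
Local Notation child := (child e root).
Local Notation leaves := (leaves e root).
Local Notation parent := (parent e root).
Local Notation res := (subtree_resistance R e root).
Local Notation cond := (branch_conductance R e root).

Fixpoint hom_count_rec (n : nat) (v : V) (k : nat) : R :=
  ((v \in leaves) ==> (k == 0%N))%:R *
  (if n is n'.+1 then \prod_(w | child v w) edge_step (hom_count_rec n' w) k
   else 1).

(* The number of homomorphisms of the subtree below v that vanish on its
   leaves and have height k at v; the height - k has the same count. *)
Definition hom_count (v : V) : nat -> R := hom_count_rec (#|V| - dist v) v.

Local Notation cnt := hom_count.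

Lemma hom_countE v k : cnt v k = ((v \in leaves) ==> (k == 0%N))%:R *
  \prod_(w | child v w) edge_step (cnt w) k.
Proof.
rewrite /cnt; have hv := dist_lt_card root tree_e v.
have -> : (#|V| - dist v)%N = (#|V| - (dist v).+1).+1 by lia.
by congr (_ * _); apply: eq_bigr => w /child_dist ->.
Qed.

Lemma hom_count_leaf v : v \in leaves -> cnt v = (fun k => (k == 0%N)%:R).
Proof.
move=> vl; apply/funext => k; rewrite hom_countE vl /= big_pred0 ?mulr1//.
exact: leafN.
Qed.

Lemma hom_count_nonleaf v : v \notin leaves ->
  cnt v = (fun k => \prod_(w | child v w) edge_step (cnt w) k).
Proof.
by move=> vl; apply/funext => k; rewrite hom_countE (negbTE vl) mul1r.
Qed.

Lemma hom_count_ge0 v k : 0 <= cnt v k.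
Proof.
elim/(tree_ind (root := root) tree_e): v k => v ih k; rewrite hom_countE mulr_ge0//.
by apply: prodr_ge0 => w vw; rewrite addr_ge0// ih.
Qed.

Lemma height_bounds_branch v : height_bounds (cond v) (edge_step (cnt v)).
Proof.
elim/(tree_ind (root := root) tree_e): v => v ih.
have [vl|vl] := boolP (v \in leaves).
  rewrite /cond subtree_resistance_leaf// add0r invr1 hom_count_leaf//.
  exact: height_bounds_leaf.
rewrite /cond subtree_resistanceE//; apply: height_bounds_edge.
  exact: branch_conductance_sum_gt0.
rewrite hom_count_nonleaf//; apply: height_bounds_prod => // w _.
exact/ltW/branch_conductance_gt0.
Qed.

Lemma height_bounds_hom_count v : v \notin leaves ->
  height_bounds (res v)^-1 (cnt v).
Proof.
move=> vl; rewrite subtree_resistanceE// invrK hom_count_nonleaf//.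
apply: height_bounds_prod => w _; last exact: height_bounds_branch.
exact/ltW/branch_conductance_gt0.
Qed.

Lemma hom_count_step2 v : v \notin leaves ->
  (1 + (res v)^-1 / 2 + (res v)^-1 ^+ 2 / 2) * cnt v 2 <= cnt v 0.
Proof.
move=> vl; rewrite subtree_resistanceE// invrK hom_count_nonleaf//.
apply: (@height_prod_step2 R V (child v) cond (fun w => edge_step (cnt w))) => w _;
  last exact: height_bounds_branch.
by rewrite ltW ?branch_conductance_gt0// branch_conductance_le1.
Qed.

Lemma hom_count_support v k : (#|V| - dist v <= k)%N -> cnt v k = 0.
Proof.
elim/(tree_ind (root := root) tree_e): v k => v ih k hk.
have := dist_lt_card root tree_e v => dv.
have [vl|vl] := boolP (v \in leaves).
  by rewrite hom_count_leaf// gt_eqF//; lia.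
have [w vw] := nonleaf vl.
rewrite hom_count_nonleaf// (bigD1 w)//= /edge_step.
have dw := child_dist vw.
case: k hk => [|k] hk; first lia.
by rewrite !ih ?addr0 ?mul0r//; lia.
Qed.

Lemma hom_count_odd v k : even_tree e root -> odd (k + dist v) -> cnt v k = 0.
Proof.
move=> even_e; elim/(tree_ind (root := root) tree_e): v k => v ih k hk.
have [vl|vl] := boolP (v \in leaves).
  by rewrite hom_count_leaf//; case: k hk => // ; rewrite add0n (negbTE (even_e v vl)).
have [w vw] := nonleaf vl.
rewrite hom_count_nonleaf// (bigD1 w)//= /edge_step.
have dw := child_dist vw.
by rewrite !ih ?addr0 ?mul0r//; case: k hk => [|k] hk; lia.
Qed.

(** The heights alternating between 0 and 1 with the parity of the distance form a homomorphism;
    evenness puts the leaves at 0. *)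
Lemma hom_count_gt0 v k : even_tree e root -> (k <= 1)%N ->
  ~~ odd (k + dist v) -> 0 < cnt v k.
Proof.
move=> even_e; elim/(tree_ind (root := root) tree_e): v k => v ih k k1 hk.
have [vl|vl] := boolP (v \in leaves).
  rewrite hom_count_leaf//; have := even_e v vl.
  by case: k k1 hk => [|[|k]] //= _ /negPn ->.
rewrite hom_count_nonleaf//.
apply: (big_ind (fun x : R => 0 < x)) => // [x y|w vw]; first exact: mulr_gt0.
have dw := child_dist vw.
rewrite /edge_step; case: k k1 hk => [|[|k]]// _ hk.
  by rewrite addr_gt0// ih//; lia.
by rewrite ltr_wpDl ?hom_count_ge0// ih//; lia.
Qed.

Lemma edge_step_absz (F : nat -> R) (x : int) :
  edge_step F `|x|%N = F `|(x + 1)%R|%N + F `|(x - 1)%R|%N.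
Proof.
case: x => [[|n]|n]; rewrite /edge_step/=.
- by congr (F _ + F _); lia.
- by congr (F _ + F _); lia.
- by rewrite addrC; congr (F _ + F _); lia.
Qed.

Local Notation homs := (zero_homs e root).

Definition extensions (U : {set V}) (psi : {ffun V -> int}) :
    set {ffun V -> int} :=
  [set phi | homs phi /\ forall v, v \in U -> phi v = psi v].

(** [psi] restricted to [U] is a partial homomorphism. As [U] is closed under parents, its
    complement splits into full subtrees that extend independently. *)
Definition admissible (U : {set V}) (psi : {ffun V -> int}) : Prop :=
  [/\ root \in U, forall v w, child v w -> w \in U -> v \in U,
      forall v w, child v w -> w \in U -> `|psi v - psi w| = 1
    & forall v, v \in leaves -> v \in U -> psi v = 0].

Lemma homs_child phi v w : homs phi -> child v w -> `|phi w - phi v| = 1.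
Proof. by case=> h _ /child_edge; rewrite distrC; exact: h. Qed.

Lemma admissible_extend U psi w j : admissible U psi -> w \notin U ->
  parent w \in U -> `|j - psi (parent w)| = 1 -> (w \in leaves -> j = 0) ->
  admissible (w |: U)%SET [ffun v => if v == w then j else psi v].
Proof.
move=> [rU anc hpsi lpsi] wU pU hj wl; split.
- by rewrite !inE rU orbT.
- move=> v x vx; rewrite !inE => /orP[/eqP xw|xU]; last by rewrite (anc v x)// orbT.
  by subst x; rewrite -(child_parent tree_e vx) pU orbT.
- move=> v x vx; rewrite !inE !ffunE.
  have [vw|vw] := eqVneq v w.
    subst v; have [xw|xw /= xU] := eqVneq x w.
      by subst x; have := child_dist vx; lia.
    by rewrite (anc w x) in wU.
  have [xw _|xw /= xU] := eqVneq x w; last exact: hpsi.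
  by subst x; rewrite -(child_parent tree_e vx) distrC.
- move=> v vl; rewrite !inE ffunE; have [vw _|_ /=] := eqVneq v w; last exact: lpsi.
  by apply: wl; rewrite -vw.
Qed.

Lemma exists_boundary (U : {set V}) : root \in U -> U != [set: V]%SET ->
  exists2 w, w \notin U & parent w \in U.
Proof.
move=> rU UT; have /existsP[w0 w0U] : [exists w, w \notin U].
  apply: contraNT UT => /existsPn h; apply/eqP/setP => w.
  by rewrite finset.in_setT; apply/negPn/h.
have [w wU wmin] := @arg_minnP _ w0 [pred w | w \notin U] (fun w => dist w) w0U.
exists w => //; apply: contraT => pU; have := wmin _ pU.
have wr : w != root by apply: contraNneq wU => ->.
by rewrite (child_dist (parentP tree_e wr)) ltnn.
Qed.

(* By induction on the complement of U, deciding between the two possible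
   heights of one vertex whose parent is in U. *)
Lemma esum_extensions U psi : admissible U psi ->
  (\esum_(phi in extensions U psi) 1 =
   (\prod_(w | (w \notin U) && (parent w \in U))
      edge_step (cnt w) `|psi (parent w)|%N)%:E :> \bar R)%E.
Proof.
move: {2}(#|~: U|)%SET (leqnn #|~: U|%SET) => n.
elim: n U psi => [|n ih] U psi Un adm; have [rU anc hpsi lpsi] := adm.
  have UT : U = [set: V]%SET.
    by move: Un; rewrite leqn0 cards_eq0 => /eqP h; rewrite -[U]finset.setCK h finset.setC0.
  rewrite big_pred0; last by move=> w; rewrite UT finset.in_setT.
  rewrite (_ : extensions U psi = [set psi]) ?esum_set1//.
  apply/seteqP; split=> [phi [_ h]|_ ->] /=.
    by apply/ffunP => v; apply: h; rewrite UT finset.in_setT.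
  split=> //; split; last by move=> v vl; apply: lpsi => //; rewrite UT finset.in_setT.
  move=> u v; rewrite (edgeE root tree_e) => /orP[uv|vu].
    by apply: hpsi => //; rewrite UT finset.in_setT.
  by rewrite distrC; apply: hpsi => //; rewrite UT finset.in_setT.
have [UT|UT] := eqVneq U [set: V]%SET.
  by apply: ih => //; rewrite UT finset.setCT cards0.
have [w wU pU] := exists_boundary rU UT.
have wr : w != root by apply: contraNneq wU => ->.
have pw := parentP tree_e wr.
set p := psi (parent w).
pose ext j : {ffun V -> int} := [ffun v => if v == w then j else psi v].
pose rest := \prod_(x | [&& x \notin U, parent x \in U & x != w])
  edge_step (cnt x) `|psi (parent x)|%N.
(* Fixing the height of [w] adds [w] to [U]; its children join the boundary and their factors form
   [cnt w]. *)
have branch j : `|j - p| = 1 ->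
    (\esum_(phi in extensions (w |: U)%SET (ext j)) 1 =
     (cnt w `|j|%N * rest)%:E :> \bar R)%E.
  (* A leaf at nonzero height breaks admissibility, so the induction hypothesis is out of reach;
     here both sides are 0. *)
  move=> hj; have [/andP[wl j0]|hwl] := boolP ((w \in leaves) && (j != 0)).
    rewrite hom_count_leaf// absz_eq0 (negbTE j0) mul0r.
    rewrite (_ : extensions _ _ = set0) ?esum_set0//.
    apply/seteqP; split=> // phi [[_ hl] h]; have := h w.
    by rewrite !inE eqxx /ext ffunE eqxx hl// => /(_ isT)/esym/eqP; rewrite (negbTE j0).
  have wl0 : w \in leaves -> j = 0.
    by move=> wl; move: hwl; rewrite wl /= negbK => /eqP.
  rewrite ih; last 2 first.
  - have : (#|(~: (w |: U))%SET| < #|(~: U)%SET|)%N.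
      apply: proper_card; rewrite properE finset.setCS finset.subsetUr/=.
      by apply/subsetPn; exists w; rewrite !inE ?eqxx.
    by move=> /leq_trans/(_ Un); rewrite ltnS.
  - exact: admissible_extend.
  congr (_%:E); rewrite hom_countE.
  have -> : ((w \in leaves) ==> (`|j|%N == 0%N)) = true.
    by apply/implyP => /wl0 ->.
  rewrite mul1r (bigID (child w))/=; congr (_ * _).
    apply: eq_big => [x|x /andP[_ wx]]; last first.
      by rewrite (child_parent tree_e wx) ffunE eqxx.
    rewrite !inE negb_or; have [wx|] := boolP (child w x); last by rewrite andbF.
    rewrite (child_parent tree_e wx) eqxx/= !andbT.
    apply/andP; split; first by apply/eqP => xw; subst x; have := child_dist wx; lia.
    by apply/negP => /(anc _ _ wx); rewrite (negbTE wU).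
  apply: eq_big => [x|x /andP[/andP[xU]]]; last first.
    move=> + wx; rewrite inE ffunE; case: eqVneq => //= pxw _.
    move: wx; rewrite childE// pxw eqxx andbT => /negPn/eqP xr.
    by move: xU; rewrite xr !inE rU orbT.
  rewrite !inE negb_or; have [->|xw]/= := eqVneq x w; first by rewrite !andbF.
  have [xU|xU]//= := boolP (x \in U).
  have xr : x != root by apply: contraNneq xU => ->.
  rewrite childE// xr/= andbT; case: eqVneq => [->|_]; last by rewrite andbT.
  by rewrite (negbTE wU) andbF.
have step (phi : {ffun V -> int}) j : extensions U psi phi -> phi w = j ->
    extensions (w |: U)%SET (ext j) phi.
  move=> [hphi h] wj; split=> // v; rewrite !inE ffunE.
  by case: eqVneq => [->|_ /=]//; exact: h.
have back (phi : {ffun V -> int}) j : extensions (w |: U)%SET (ext j) phi ->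
    extensions U psi phi /\ phi w = j.
  move=> [hphi h]; split; last by rewrite h ?inE ?eqxx// ffunE eqxx.
  split=> // v vU; rewrite h ?inE ?vU ?orbT// ffunE.
  by case: eqVneq => // vw; rewrite -vw vU in wU.
rewrite [LHS](esumID [set phi : {ffun V -> int} | phi w = p + 1]); last by [].
rewrite [X in esum X _](_ : _ = extensions (w |: U)%SET (ext (p + 1))); last first.
  apply/seteqP; split=> phi; first by move=> [? ?]; exact: step.
  by move=> /back[? ?]; split.
rewrite [X in (_ + esum X _)%E](_ : _ = extensions (w |: U)%SET (ext (p - 1))); last first.
  apply/seteqP; split=> phi.
    move=> [hphi /= wp]; apply: step => //.
    have := homs_child hphi.1 pw; rewrite (hphi.2 _ pU) -/p; lia.
  by move=> /back[? ?]; split=> //=; lia.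
rewrite !branch; [|lia|lia].
rewrite -EFinD -mulrDl -edge_step_absz; congr (_%:E).
rewrite [RHS](bigD1 w)/= ?wU ?pU//; congr (_ * _).
by apply: eq_bigl => x; rewrite andbA.
Qed.

Lemma esum_root_height (x : int) :
  (\esum_(phi in [set phi | homs phi /\ phi root = x]) 1 =
   (cnt root `|x|%N)%:E :> \bar R)%E.
Proof.
have [/andP[rl x0]|hr] := boolP ((root \in leaves) && (x != 0)).
  rewrite hom_count_leaf// absz_eq0 (negbTE x0).
  rewrite (_ : [set phi | _] = set0) ?esum_set0//.
  apply/seteqP; split=> // phi /= [[_ h] hx].
  by move: x0; rewrite -hx h ?eqxx.
pose psi : {ffun V -> int} := [ffun=> x].
have adm : admissible [set root]%SET psi.
  split; rewrite ?inE//.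
  - by move=> v w vw; rewrite !inE => /eqP wr; have := child_neq_root vw; rewrite wr eqxx.
  - by move=> v w vw; rewrite !inE => /eqP wr; have := child_neq_root vw; rewrite wr eqxx.
  - move=> v vl; rewrite inE ffunE => /eqP vr; move: hr vl; rewrite vr.
    by move=> /[swap] ->; rewrite /= negbK => /eqP.
rewrite (_ : [set phi | _] = extensions [set root]%SET psi); last first.
  apply/seteqP; split=> phi [hphi h]; split=> //.
    by move=> v; rewrite inE => /eqP ->; rewrite ffunE.
  by rewrite h ?inE// ffunE.
rewrite esum_extensions//; congr (_%:E); rewrite hom_countE.
have -> : ((root \in leaves) ==> (`|x|%N == 0%N)) = true.
  apply/implyP => rl; move: hr; rewrite rl /= negbK => /eqP ->//.
rewrite mul1r; apply: eq_big => [w|w _]; last by rewrite ffunE.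
by rewrite !inE childE.
Qed.

Lemma esum_abs_root_height (n : nat) :
  weight_measure (@uniform_weight_ge0 R _ homs) [set phi | `|phi root|%N = n] =
  (cnt root n *+ fiber_size n)%:E.
Proof.
rewrite /weight_measure.
have -> : (\esum_(phi in [set phi : {ffun V -> int} | `|phi root|%N = n])
     (\1_homs phi)%:E = \esum_(phi in [set phi | homs phi /\ `|phi root|%N = n]) 1
     :> \bar R)%E.
  rewrite (_ : [set phi | homs phi /\ _] =
      [set phi : {ffun V -> int} | `|phi root|%N = n] `&` homs).
    rewrite esum_mkcondr; apply: eq_esum => phi _.
    by rewrite indicE; case: (phi \in homs).
  by apply/seteqP; split=> phi [].
case: n => [|n] /=.
  rewrite mulr1n -(esum_root_height 0); congr esum.
  by apply/seteqP; split=> phi [hphi /= h]; split=> //; lia.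
rewrite [LHS](esumID [set phi : {ffun V -> int} | phi root = n.+1%:Z]); last by [].
rewrite [X in esum X _](_ : _ = [set phi | homs phi /\ phi root = n.+1%:Z]);
  last first.
  by apply/seteqP; split=> phi /=; [move=> [[]]|move=> [? h]; rewrite h].
rewrite [X in (_ + esum X _)%E]
    (_ : _ = [set phi | homs phi /\ phi root = - n.+1%:Z]); last first.
  apply/seteqP; split=> phi /=; first by move=> [[? h] ?]; split=> //; lia.
  by move=> [? h]; rewrite h; do !split=> //; lia.
by rewrite !esum_root_height abszN -EFinD mulr2n.
Qed.

End Counting.

(** * Integrals against laws with finitely many levels *)

Section FiniteLevels.
Variable R : realType.

Lemma esum_nat_finite (a : nat -> R) (N : nat) : (forall n, 0 <= a n) ->
  (forall n, (N <= n)%N -> a n = 0) -> forall B : set nat,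
  (\esum_(n in B) (a n)%:E = \sum_(n < N) (a n)%:E * dirac (nat_of_ord n) B)%E.
Proof.
move=> a0 aN B; rewrite esum_mkcond -nneseries_esumT; last first.
  by move=> n; case: ifP => // _; rewrite lee_fin.
have term (n : nat) :
    (if n \in B then (a n)%:E else 0%E) = ((a n)%:E * dirac n B)%E.
  by rewrite diracE; case: (n \in B); rewrite ?mule1 ?mule0.
apply: lim_near_cst => //; near=> n.
have Nn : (N <= n)%N by near: n; exact: nbhs_infty_ge.
rewrite (big_cat_nat (n := N))//= [X in (_ + X)%E]big1_seq ?adde0.
  by rewrite big_mkord; apply: eq_bigr => i _; rewrite term.
move=> i; rewrite mem_index_iota => /andP[_ /andP[Ni _]].
by rewrite term aN// mul0e.
Unshelve. all: by end_near. Qed.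

Lemma sum_even_levels (a : nat -> R) (M : nat) :
  (forall n, odd n -> a n = 0) ->
  \sum_(n < M.*2.+1) a n = a 0%N + \sum_(n < M) a n.+1.*2.
Proof.
move=> aodd; elim: M => [|M ih]; first by rewrite big_ord_recr !big_ord0/= addrC.
rewrite doubleS big_ord_recr big_ord_recr/= ih [in RHS]big_ord_recr/=.
by rewrite (aodd M.*2.+1) ?addr0 ?addrA//= odd_double.
Qed.

Variables (X : zmodType) (w : X -> R) (w_ge0 : forall x, 0 <= w x).
Variables (K : X -> nat) (a : nat -> R) (N : nat) (m : R).
Hypothesis level : forall n,
  weight_measure w_ge0 [set x | K x = n] = (a n)%:E.
Hypothesis support : forall n, (N <= n)%N -> a n = 0.
Hypotheses (m_gt0 : 0 < m) (total : m = \sum_(n < N) a n).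

Let a_ge0 n : 0 <= a n. Proof. exact: level_ge0 level n. Qed.

Lemma esum_total : (\esum_(n in setT) (a n)%:E = m%:E)%E.
Proof.
rewrite (esum_nat_finite a_ge0 support) total -sumEFin.
by apply: eq_bigr => n _; rewrite diracT mule1.
Qed.

Let p_ge0 n : 0 <= a n / m. Proof. by rewrite divr_ge0// ltW. Qed.

(** The image of the law under [K] is a finite combination of Dirac masses on [nat]. *)
Lemma ge0_integral_levels (g : nat -> \bar R) : (forall n, 0 <= g n)%E ->
  (\int[proportional_law w_ge0]_x g (K x) = \sum_(n < N) (a n / m)%:E * g n)%E.
Proof.
move=> g0.
have mK : measurable_fun [set: discrete X] (K : discrete X -> nat) by [].
transitivity (\int[pushforward (proportional_law w_ge0) (K : discrete X -> nat)]_n g n)%E.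
  by rewrite ge0_integral_pushforward// => n _.
pose mu (n : nat) : {measure set nat -> \bar R} := mscale (NngNum (p_ge0 n)) (dirac n).
transitivity (\int[msum mu N]_n g n)%E.
  apply: eq_measure_integral => A _ _.
  rewrite /pushforward/= /msum.
  rewrite [LHS](proportional_law_levels level m_gt0 esum_total A).
  rewrite (esum_nat_finite a_ge0 support) ge0_sume_distrl; last first.
    by move=> n _; rewrite mule_ge0// lee_fin.
  apply: eq_bigr => n _.
  transitivity ((a n / m)%:E * dirac (nat_of_ord n) A)%E; last by [].
  by rewrite EFinM -!muleA; congr (_ * _)%E; exact: muleC.
rewrite ge0_integral_measure_sum//; apply: eq_bigr => n _.
by rewrite ge0_integral_mscale// integral_dirac// diracT mul1e.
Qed.

End FiniteLevels.

(** Positive and negative parts have equal integrals. Finite ones cancel; infinite ones leave an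
    infinite difference, which [fine] sends to 0. The variance is centred at this [fine] value. *)
Lemma fine_integral_antisymmetric (R : realType) (d : measure_display)
    (T : measurableType d) (P : {measure set T -> \bar R}) (s : T -> T)
    (f : T -> \bar R) : measurable_fun setT s ->
  (forall A, measurable A -> P (s @^-1` A) = P A) -> measurable_fun setT f ->
  (forall x, f (s x) = - f x)%E -> fine (\int[P]_x f x)%E = 0.
Proof.
move=> ms Ps mf fs; rewrite integralE.
have -> : (\int[P]_x f^\- x = \int[P]_x f^\+ x)%E.
  transitivity (\int[pushforward P s]_x f^\+ x)%E.
    rewrite ge0_integral_pushforward//; last exact: measurable_funepos.
    by apply: eq_integral => x _; rewrite /= funeposE funenegE fs.
  by apply: eq_measure_integral => A mA _; exact: Ps.
by case: (\int[P]_x _)%E => [r||] //=; rewrite subrr.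
Qed.

(** * Levels of a symmetric discrete Gaussian *)

Section GaussianLaw.
Variables (R : realType) (I : set int) (s2 : R).
Hypotheses (s2_gt0 : 0 < s2) (I_sym : forall x, I (- x) <-> I x) (I0 : I 0).

Lemma gauss_weightN (x : int) : gauss_weight I s2 (- x) = gauss_weight I s2 x.
Proof.
rewrite /gauss_weight rmorphN sqrrN !indicE; congr ((nat_of_bool _)%:R * _).
by apply/idP/idP; rewrite !inE => /I_sym.
Qed.

Lemma gauss_weightE (n : nat) : I n%:Z ->
  gauss_weight I s2 n%:Z = expR (- (n%:R ^+ 2 / (2 * s2))).
Proof. by move=> In; rewrite /gauss_weight indicE mem_set// mul1r. Qed.

Lemma gauss_weight_out (x : int) : ~ I x -> gauss_weight I s2 x = 0.
Proof. by move=> Ix; rewrite /gauss_weight indicE memNset// mul0r. Qed.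

Lemma discrete_gaussian_levels : exists2 m : R, 0 < m &
  (\esum_(n in setT) (gauss_weight I s2 n%:Z *+ fiber_size n)%:E = m%:E)%E /\
  forall B : set nat, discrete_gaussian I s2 [set x | B `|x|%N] =
   ((\esum_(n in B) (gauss_weight I s2 n%:Z *+ fiber_size n)%:E) * (m^-1)%:E)%E.
Proof.
set b := fun n : nat => gauss_weight I s2 n%:Z *+ fiber_size n.
have level := weight_measure_absz (gauss_weight_ge0 I s2) gauss_weightN.
have b0 n : 0 <= b n by rewrite mulrn_wge0// gauss_weight_ge0.
have fin : (\esum_(n in setT) (b n)%:E < +oo)%E.
  apply: (esum_gauss_lty s2_gt0) => n; rewrite b0/= lerMn2r; apply/orP; right.
  by rewrite /gauss_weight ler_piMl ?expR_ge0// indicE; case: (_ \in _).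
have pos : (1 <= \esum_(n in setT) (b n)%:E)%E.
  apply: esum_ge; exists [set 0%N]; first by split.
  by rewrite fsbig_set1 lee_fin /b mulr1n gauss_weightE// expr0n/= mul0r oppr0 expR0.
case E : (\esum_(n in setT) (b n)%:E)%E fin pos => [m||]// _; rewrite lee_fin => m1.
have m0 : 0 < m by rewrite (lt_le_trans _ m1).
by exists m => //; split=> // B; have := proportional_law_levels level m0 E B; apply.
Qed.

End GaussianLaw.

(** * Law and variance of the height at the root *)

Section RootHeight.
Variables (R : realType) (V : finType) (e : rel V) (root : V).
Hypotheses (tree_e : is_tree e) (even_e : even_tree e root).

Local Notation F := (hom_count R e root root).
Local Notation r := (subtree_resistance R e root root).
Local Notation P := (random_zero_hom R e root).
Local Notation height := (fun phi : discrete {ffun V -> int} => (phi root)%:~R : R).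

Definition root_level (n : nat) : R := F n *+ fiber_size n.
(** The cut lies beyond the support and ends on an even level, as [sum_even_levels] expects. *)
Definition root_mass : R := \sum_(n < #|V|.*2.+1) root_level n.

Local Notation a := root_level.
Local Notation m := root_mass.

Let level n : weight_measure (@uniform_weight_ge0 R _ (zero_homs e root))
  [set phi | `|phi root|%N = n] = (a n)%:E.
Proof. exact: esum_abs_root_height. Qed.

Let a_ge0 n : 0 <= a n. Proof. exact: level_ge0 level n. Qed.

Lemma root_count_odd n : odd n -> F n = 0.
Proof. by move=> on; rewrite hom_count_odd// dist_root addn0. Qed.

Lemma root_count_double : F #|V|.*2 = 0.
Proof. by rewrite hom_count_support//; lia. Qed.

Lemma root_level_support n : (#|V|.*2.+1 <= n)%N -> a n = 0.
Proof. by move=> hn; rewrite /a hom_count_support// ?mul0rn//; lia. Qed.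

Lemma root_massE : m = F 0 + \sum_(n < #|V|) 2 * F n.+1.*2.
Proof.
rewrite /m sum_even_levels => [|n on]; last by rewrite /a root_count_odd// mul0rn.
by congr (_ + _); apply: eq_bigr => n _; rewrite /a mulr_natl.
Qed.

Lemma root_mass_gt0 : 0 < m.
Proof.
rewrite root_massE ltr_pwDl//; first by rewrite hom_count_gt0// dist_root.
by apply: sumr_ge0 => n _; rewrite mulr_ge0// hom_count_ge0.
Qed.

Lemma root_total : (\esum_(n in setT) (a n)%:E = m%:E)%E.
Proof. exact: esum_total level root_level_support erefl. Qed.

Lemma random_zero_hom_levels (B : set nat) :
  P [set phi | B `|phi root|%N] = ((\esum_(n in B) (a n)%:E) * (m^-1)%:E)%E.
Proof. by have := proportional_law_levels level root_mass_gt0 root_total B; apply. Qed.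

Definition root_second_moment : R := \sum_(n < #|V|) 8 * n.+1%:R ^+ 2 * F n.+1.*2.

Local Notation S := root_second_moment.

Lemma expectation_root_height : fine 'E_P[height] = 0.
Proof.
rewrite unlock.
apply: (@fine_integral_antisymmetric R _ (discrete {ffun V -> int}) P
  (fun phi : {ffun V -> int} => - phi)) => //.
- move=> A _; rewrite [LHS](proportional_lawE level root_mass_gt0 root_total).
  rewrite [RHS](proportional_lawE level root_mass_gt0 root_total).
  congr (_ * _)%E; rewrite /weight_measure [RHS](@reindex_esum _ _ _
    ((fun phi : {ffun V -> int} => - phi) @^-1` A) _
    (fun phi : {ffun V -> int} => - phi)); last first.
    split; [by []|by move=> x y _ _; exact: oppr_inj|].
    by move=> x Ax; exists (- x); rewrite /= ?opprK.
  apply: eq_esum => phi _; rewrite !indicE; congr ((nat_of_bool _)%:R%:E).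
  have homsN (psi : {ffun V -> int}) : zero_homs e root psi -> zero_homs e root (- psi).
    move=> [h1 h2]; split=> [u v euv|v vl]; rewrite !ffunE.
      by rewrite -opprD normrN h1.
    by rewrite h2// oppr0.
  apply/idP/idP; rewrite !inE => /homsN//.
  by rewrite opprK.
- by move=> phi; rewrite ffunE rmorphN EFinN.
Qed.

Lemma variance_root_height : ('V_P[height] = (S / m)%:E)%E.
Proof.
rewrite /variance unlock expectation_root_height unlock.
pose g (n : nat) : \bar R := (n%:R ^+ 2)%:E.
transitivity (\int[P]_phi g `|phi root|%N)%E.
  apply: eq_integral => phi _; rewrite /g /= !fctE/= subr0 -expr2.
  by rewrite natr_absz intr_norm real_normK// num_real.
rewrite (ge0_integral_levels level root_level_support root_mass_gt0 erefl);
  last by move=> n; rewrite lee_fin sqr_ge0.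
transitivity (\sum_(n < #|V|.*2.+1) (a n * n%:R ^+ 2 / m)%:E)%E.
  by apply: eq_bigr => n _; rewrite /g -EFinM mulrAC.
rewrite sumEFin -mulr_suml; congr (_ / _)%:E.
rewrite (@sum_even_levels _ (fun n => a n * n%:R ^+ 2)); last first.
  by move=> n on; rewrite /a root_count_odd// mul0rn mul0r.
rewrite expr0n/= mulr0 add0r; apply: eq_bigr => n _.
by rewrite /a -mul2n natrM /= mulr2n; ring.
Qed.

Lemma root_second_moment_ge0 : 0 <= S.
Proof.
by apply: sumr_ge0 => n _; rewrite !mulr_ge0 ?sqr_ge0// hom_count_ge0.
Qed.

(** Comparing this sum with [c * F 0] amounts to comparing [S] with [c * m]; the values used are
    [4 * r] from above and [r - 1] from below. *)
Lemma moment_split (c : R) :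
  \sum_(n < #|V|) (8 * n.+1%:R ^+ 2 - c * 2) * F n.+1.*2 = S - c * (m - F 0).
Proof.
rewrite root_massE [F 0 + _]addrC addrK mulr_sumr -sumrB.
by apply: eq_bigr => n _; ring.
Qed.

Lemma root_second_moment_le : S <= 4 * r * m.
Proof.
have [rl|rl] := boolP (root \in leaves e root).
  rewrite subtree_resistance_leaf// mulr0 mul0r /S big1// => n _.
  by rewrite hom_count_leaf// mulr0.
have r0 : 0 < r by exact: subtree_resistance_gt0.
have hF := height_bounds_hom_count R tree_e rl.
suff : \sum_(n < #|V|) (8 * n.+1%:R ^+ 2 - 8 * r) * F n.+1.*2 <= 4 * r * F 0.
  by rewrite (_ : 8 * r = 4 * r * 2) ?moment_split; [lra|ring].
have [r1|/ltW r1] := leP 1 r.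
  exact: second_moment_le_ge1 root_count_double.
apply: second_moment_le_le1 => //; first exact: root_count_double.
exact: hom_count_step2.
Qed.

Lemma root_second_moment_ge : (r - 1) * m <= S.
Proof.
have [rl|rl] := boolP (root \in leaves e root).
  have := root_second_moment_ge0; have := root_mass_gt0.
  by rewrite subtree_resistance_leaf//; lra.
have r0 : 0 < r by exact: subtree_resistance_gt0.
have hF := height_bounds_hom_count R tree_e rl.
have := second_moment_ge r0 hF root_count_double.
rewrite (eq_bigr (fun n : 'I__ => (8 * n.+1%:R ^+ 2 - (r - 1) * 2) * F n.+1.*2)).
  by rewrite moment_split; lra.
by move=> n _; congr (_ * _); lra.
Qed.

Lemma mulrnMn (x y : R) (p q : nat) : (x *+ p) * (y *+ q) = (x * y) *+ (q * p).
Proof. by rewrite mulrnAl mulrnAr mulrnA. Qed.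

Lemma root_height_le_gauss (B : set nat) :
  root \notin leaves e root -> (forall i j, B j -> ~ B i -> (i < j)%N) ->
  (P [set phi | B `|phi root|%N] <=
   discrete_gaussian evenZ (4 * r) [set x | B `|x|%N])%E.
Proof.
move=> rl hB.
have r0 : 0 < r by exact: subtree_resistance_gt0.
have hF := height_bounds_hom_count R tree_e rl.
have [|||mb mb0 [tot ->]] := @discrete_gaussian_levels R evenZ (4 * r).
- by rewrite mulr_gt0.
- by move=> x; rewrite /evenZ/=; split; lia.
- by [].
rewrite random_zero_hom_levels; apply: esum_up_le root_mass_gt0 mb0 root_total tot _ => //.
  by move=> n; rewrite mulrn_wge0// gauss_weight_ge0.
move=> i j Bj Bi; have ij := hB _ _ Bj Bi.
rewrite /a !mulrnMn [X in _ *+ X]mulnC lerMn2r; apply/orP; right.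
rewrite !gauss_weight_even.
have [oi|ei] := boolP (odd i); first by rewrite mulr0 root_count_odd// mul0r.
have [oj|ej] := boolP (odd j); first by rewrite mulr0 root_count_odd// mul0r.
have -> : i = i./2.*2 by rewrite even_halfK.
have -> : j = j./2.*2 by rewrite even_halfK.
by apply: height_le_gauss => //; apply: half_leq; apply: ltnW.
Qed.

Lemma gauss_le_root_height (B : set nat) :
  root \notin leaves e root -> (forall i j, B j -> ~ B i -> (i < j)%N) ->
  (discrete_gaussian (evenZ `&` sym_interval (r / 2)) (r / 4) [set x | B `|x|%N]
   <= P [set phi | B `|phi root|%N])%E.
Proof.
move=> rl hB.
have r0 : 0 < r by exact: subtree_resistance_gt0.
have hF := height_bounds_hom_count R tree_e rl.
set I := evenZ `&` _.
have [|||mb mb0 [tot ->]] := @discrete_gaussian_levels R I (r / 4).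
- by rewrite divr_gt0.
- move=> x; rewrite /I /evenZ /sym_interval/= rmorphN ltrN2 ltrNl andbC.
  by split=> -[h ?]; split=> //; lia.
- by split=> //=; rewrite /sym_interval/= oppr_lt0 divr_gt0.
rewrite random_zero_hom_levels; apply: esum_up_le mb0 root_mass_gt0 tot root_total _ => //.
  by move=> n; rewrite mulrn_wge0// gauss_weight_ge0.
move=> i j Bj Bi; have ij := hB _ _ Bj Bi.
rewrite /a !mulrnMn [X in _ *+ X]mulnC lerMn2r; apply/orP; right.
have [Ij|Ij] := pselect (I j%:Z); last first.
  by rewrite gauss_weight_out// mul0r mulr_ge0 ?gauss_weight_ge0 ?hom_count_ge0.
have [oi|ei] := boolP (odd i).
  by rewrite root_count_odd// mulr0 mulr_ge0 ?gauss_weight_ge0 ?hom_count_ge0.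
have [ej jr] : ~~ odd j /\ j%:R < r / 2.
  by case: Ij; rewrite /evenZ /sym_interval/= => ? /andP[_ ?]; split=> //; lia.
have Ii : I i%:Z.
  split; first by rewrite /evenZ/=; lia.
  have ir : i%:R < r / 2 by apply: le_lt_trans jr; rewrite ler_nat ltnW.
  rewrite /sym_interval/= -[i%:~R]/(i%:R : R) ir andbT.
  by apply: (@lt_le_trans _ _ 0) => //; rewrite oppr_lt0 divr_gt0.
rewrite !gauss_weightE//.
have jE : j = j./2.*2 by rewrite even_halfK.
have -> : i = i./2.*2 by rewrite even_halfK.
rewrite jE in jr *.
by apply: gauss_le_height => //; apply: half_leq; apply: ltnW.
Qed.

End RootHeight.

(** * Degenerate laws and the final assembly *)

Lemma proportional_law0 (R : realType) (X : zmodType) (w : X -> R)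
    (w_ge0 : forall x, 0 <= w x) (A : set X) :
  (forall x, w x = 0) -> ~ A 0 -> proportional_law w_ge0 A = 0%E.
Proof.
move=> w0 A0; rewrite /proportional_law /= /mnormalize.
have mT : weight_measure w_ge0 [set: X] = 0%E.
  by apply: esum1 => x _; rewrite w0.
rewrite -[X in if X then _ else _]/((weight_measure w_ge0 [set: X] == 0) ||
  (weight_measure w_ge0 [set: X] == +oo))%E mT eqxx /=.
by rewrite diracE memNset.
Qed.

(** For [r] below the denominator [D] the floor is 0; beyond it [r / D <= r - 1], because
    [D >= 4]. *)
Lemma floor_variance_bound (R : realType) (r : R) : 0 <= r ->
  (Num.floor (r / (4 * expR 4 * Num.sqrt pi)))%:~R <= Num.max 0 (r - 1).
Proof.
move=> r0; set D := 4 * expR 4 * Num.sqrt pi.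
have D4 : 4 <= D.
  have e1 : 1 <= expR 4 :> R by rewrite -expR0 ler_expR.
  have s1 : 1 <= Num.sqrt pi :> R.
    by rewrite -sqrtr1 ler_sqrt ?pi_gt0// (le_trans _ (pi_ge2 R))// ler1n.
  have es : 1 * 1 <= expR 4 * Num.sqrt pi :> R by apply: ler_pM.
  by rewrite /D; lra.
have D0 : 0 < D by lra.
have [rD|Dr] := ltP r D.
  rewrite (_ : Num.floor _ = 0) ?le_max ?lexx//.
  apply: floor_def; rewrite add0r -[1%:~R]/(1 : R); apply/andP; split.
    by apply: divr_ge0 => //; exact: ltW.
  by rewrite ltr_pdivrMr// mul1r.
apply: le_trans (floor_le _) _; rewrite le_max; apply/orP; right.
rewrite ler_pdivrMr//; nra.
Qed.

Theorem theorem1p2 (R : realType) (V : finType) (e : rel V) (root : V)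
    (tree_e : is_tree e) (even_e : even_tree e root) :
  let rho : R := leaf_resistance R e root in
  let P := random_zero_hom R e root in
  let height := (fun phi : discrete {ffun V -> int} => (phi root)%:~R : R) in
  let abs_int := (fun x : discrete int => `|x%:~R| : R) in
  [/\ st_le (discrete_gaussian (evenZ `&` sym_interval (rho / 2)) (rho / 4))
        abs_int P (fun phi => `|height phi|),
      st_le P (fun phi => `|height phi|)
        (discrete_gaussian evenZ (4 * rho)) abs_int
    & (((Num.floor (rho / (4 * expR 4 * Num.sqrt pi)))%:~R : R)%:E
         <= 'V_P[height])%E /\ ('V_P[height] <= (4 * rho)%:E)%E ].
Proof.
move=> rho P height abs_int.
have rhoE : rho = subtree_resistance R e root root by exact: leaf_resistanceE.
pose up (t : R) := [set n : nat | t <= n%:R].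
have up_lt t i j : up t j -> ~ up t i -> (i < j)%N.
  rewrite /up/= => tj /negP; rewrite -ltNge => it.
  by rewrite -(ltr_nat R) (lt_le_trans it).
have PE (t : R) : [set phi : {ffun V -> int} | t <= `|(phi root)%:~R : R|] =
    [set phi | up t `|phi root|%N].
  by apply/seteqP; split=> phi; rewrite /up/= natr_absz intr_norm.
have QE (t : R) : [set x : int | t <= `|x%:~R : R|] = [set x | up t `|x|%N].
  by apply/seteqP; split=> x; rewrite /up/= natr_absz intr_norm.
have leaf_tail t : root \in leaves e root -> 0 < t ->
    P [set phi | up t `|phi root|%N] = 0%E.
  move=> rl t0; rewrite random_zero_hom_levels// esum1 ?mul0e// => -[|n].
    by rewrite /up/= leNgt t0.
  by rewrite /root_level hom_count_leaf// mul0rn.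
split=> [t|t|].
- rewrite /st_le PE QE rhoE.
  (* If the root is a leaf, the interval of truncation is empty and the Gaussian degenerates to the
     Dirac mass at 0, which is also where the height sits. *)
  have [rl|rl] := boolP (root \in leaves e root); last first.
    by apply: gauss_le_root_height => // i j; exact: up_lt.
  have [t0|t0] := ltP 0 t.
    rewrite leaf_tail// subtree_resistance_leaf//.
    rewrite [leLHS]proportional_law0//; last by rewrite /up/= leNgt t0.
    move=> x; rewrite /gauss_weight indicE memNset ?mul0r//= => -[_].
    by rewrite /sym_interval/= oppr0 => /andP[/lt_trans h /h]; rewrite ltxx.
  rewrite [X in (_ <= _ X)%E](_ : _ = setT) ?probability_setT ?probability_le1//.
  by apply/seteqP; split=> // phi _; rewrite /up/= (le_trans t0).
- rewrite /st_le PE QE rhoE.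
  have [rl|rl] := boolP (root \in leaves e root); last first.
    by apply: root_height_le_gauss => // i j; exact: up_lt.
  have [t0|t0] := ltP 0 t; first by rewrite leaf_tail.
  rewrite [X in (_ <= _ X)%E](_ : _ = setT) ?probability_setT ?probability_le1//.
  by apply/seteqP; split=> // x _; rewrite /up/= (le_trans t0).
- rewrite variance_root_height// !lee_fin rhoE.
  have m0 := root_mass_gt0 R tree_e even_e.
  have r0 := @subtree_resistance_ge0 R V e root tree_e root.
  split; last by rewrite ler_pdivrMr// root_second_moment_le.
  apply: le_trans (floor_variance_bound r0) _; rewrite ge_max.
  apply/andP; split; first by rewrite divr_ge0 ?root_second_moment_ge0// ltW.
  by rewrite ler_pdivlMr// root_second_moment_ge.
Qed.
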